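(* Let $(X,d)$ be a nonempty complete metric space, let $w_1,\dots,w_N:X\to X$ be Rakotch contractions, and let $\vec p=(p_1,\dots,p_N)$ with $p_i>0$ and $\sum_{i=1}^N p_i=1$. Let $M:\mathcal{M}_{\pm}(X)\to\mathcal{M}_{\pm}(X)$, $M(\mu)=\sum_{i=1}^N p_i\,\mu\circ w_i^{-1}$, be the Markov operator induced by the probabilistic IFS $(\{w_1,\dots,w_N\},\vec p)$. Then: (a) $M(\mathcal{P}_1(X))\subseteq\mathcal{P}_1(X)$; (b) $M:\mathcal{P}_1(X)\to\mathcal{P}_1(X)$ is a Rakotch contraction with respect to the Monge–Kantorovich metric $d_{MK}$; (c) $M$ has a contractive fixed point in $\mathcal{P}_1(X)$, i.e. there exists a unique $\mu_*\in\mathcal{P}_1(X)$ such that $M(\mu_* )=\mu_*$ and, for every $\mu\in\mathcal{P}_1(X)$, the sequence $M^k(\mu)$ converges weakly to $\mu_*$.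
   Context: A selfmap $f$ of a metric space $(Y,\rho)$ is a Rakotch contraction if there is a nonincreasing $\lambda:[0,\infty)\to[0,1]$ with $\lambda(t)<1$ for $t>0$ such that $\rho(f(x),f(y))\le\lambda(\rho(x,y))\,\rho(x,y)$ for all $x,y\in Y$. A (finite nonnegative) Borel measure $\mu$ on a Hausdorff space $X$ is Radon if $\mu(B)=\sup\{\mu(K):K\subseteq B,\ K\text{ compact}\}$ for every Borel $B$; a signed Radon measure is a difference of two such measures, and $\mathcal{M}_{\pm}(X)$ is the space of signed Radon measures. $\mu\circ w^{-1}$ denotes the push-forward $B\mapsto\mu(w^{-1}(B))$. $\mathcal{P}_1(X)$ is the set of Radon probability measures $\mu$ on $X$ with $\int_X d(x,x_0)\,d\mu(x)<\infty$ for some (equivalently every) $x_0\in X$. The Monge–Kantorovich metric on $\mathcal{P}_1(X)$ is $$d_{MK}(\mu,\nu)=\sup\left\{\int_X f\,d\mu-\int_X f\,d\nu:\ f:X\to\mathbb{R},\ \operatorname{Lip}(f)\le1\right\}.$$ Weak convergence $\mu_n\to\mu$ means $\int_X f\,d\mu_n\to\int_X f\,d\mu$ for all bounded continuous $f:X\to\mathbb{R}$. *)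

(* Defs.v *)
From HB Require Import structures.
From mathcomp Require Import all_boot all_order all_algebra.
From mathcomp Require Import all_classical all_reals all_analysis.

Set Implicit Arguments.
Unset Strict Implicit.
Unset Printing Implicit Defensive.
Import Order.TTheory GRing.Theory Num.Theory.
Import numFieldNormedType.Exports.

Local Open Scope classical_set_scope.
Local Open Scope ring_scope.

(* [Complete] already requires a point, so these spaces are nonempty. *)
#[short(type="completeMetricType")]
HB.structure Definition CompleteMetric (R : numDomainType) :=
  {T of Complete T & Metric R T}.

(* [f] is a selfmap of the subspace [A] of [(Y, rho)]; only the values of
   [lambda] on [0, +oo) matter. *)
Definition rakotch_contraction (R : realType) (Y : Type) (rho : Y -> Y -> R)
    (A : set Y) (f : Y -> Y) : Prop :=
  (forall x, A x -> A (f x)) /\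
  exists lambda : R -> R,
    [/\ forall t, 0 <= t -> 0 <= lambda t <= 1,
        forall s t, 0 <= s -> s <= t -> lambda t <= lambda s,
        forall t, 0 < t -> lambda t < 1 &
        forall x y, A x -> A y -> rho (f x) (f y) <= lambda (rho x y) * rho x y].

Lemma rakotch_continuous (R : realType) (X : metricType R) (f : X -> X) :
  rakotch_contraction (@mdist R X) setT f -> continuous f.
Proof.
move=> [_ [l [l01 _ _ fl]]] x; apply/cvg_ballP => e e0.
near=> y; rewrite ballEmdist /=.
apply: (le_lt_trans (fl _ _ I I)).
apply: (@le_lt_trans _ _ (mdist x y)).
  by rewrite ler_piMl ?mdist_ge0//; case/andP: (l01 _ (mdist_ge0 x y)).
by have : ball x e y by [near: y; exact: nbhsx_ballx]; rewrite ballEmdist.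
Unshelve. all: by end_near. Qed.

Notation borelType X := (g_sigma_algebraType (@open X)).

Section radon.
Context {R : realType} (X : ptopologicalType).
Local Open Scope ereal_scope.
Implicit Type mu : set (borelType X) -> \bar R.

Definition radon mu : Prop := forall B : set (borelType X), measurable B ->
  mu B = ereal_sup [set mu K | K in [set K : set X | compact K /\ K `<=` B]].

(* Library set functions are defined on all sets. The value 0 is forced outside
   the Borel sets, so that Leibniz equality is equality of signed measures. *)
Record signed_radon := SignedRadon {
  signed_radon_val :> set (borelType X) -> \bar R ;
  signed_radon_out : forall B, ~ measurable B -> signed_radon_val B = 0 ;
  signed_radon_diff :
    exists m1 m2 : {finite_measure set (borelType X) -> \bar R},
      [/\ radon m1, radon m2 &
          forall B, measurable B -> signed_radon_val B = m1 B - m2 B] }.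

End radon.
Arguments signed_radon R X : clear implicits.

Section markov_operator.
Context {R : realType} {X : completeMetricType R} {N : nat}.
Local Open Scope ereal_scope.
Variables (w : 'I_N -> X -> X) (p : 'I_N -> R).

Local Notation Y := (borelType X).

Definition markov_val (mu : set Y -> \bar R) : set Y -> \bar R := fun B =>
  if `[< measurable B >] then \sum_(i < N) (p i)%:E * pushforward mu (w i : Y -> Y) B
  else 0.

Hypotheses (w_cont : forall i, continuous (w i)) (p_gt0 : forall i, (0 < p i)%R).

Let borel_compact (K : set X) : compact K -> measurable (K : set Y).
Proof.
move=> cK; rewrite -[K]setCK; apply: (@measurableC _ Y).
apply: sub_sigma_algebra; apply: closed_openC.
exact: compact_closed (@metric_hausdorff _ X) cK.
Qed.

Let borel_preimage i (B : set Y) : measurable B -> measurable ((w i : Y -> Y) @^-1` B).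
Proof.
suff wm : measurable_fun [set: Y] (w i : Y -> Y).
  by move=> mB; rewrite -[X in measurable X]setTI; exact: wm.
apply: (@measurability _ _ Y Y _ _ (@open X)) => // _ [A oA <-].
by apply: sub_sigma_algebra; rewrite setTI; move/continuousP : (@w_cont i); exact.
Qed.

Section image_measure.
Variable m : {finite_measure set Y -> \bar R}.

Definition markov_msr (A : set Y) : \bar R :=
  \sum_(i < N) (p i)%:E * m ((w i : Y -> Y) @^-1` A).

Let msr0 : markov_msr set0 = 0.
Proof. by rewrite /markov_msr big1// => i _; rewrite preimage_set0 measure0 mule0. Qed.

Let msr_ge0 A : 0 <= markov_msr A.
Proof. by apply: sume_ge0 => i _; rewrite mule_ge0// lee_fin ltW. Qed.

Let msr_sigma_additive : semi_sigma_additive markov_msr.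
Proof.
move=> F mF tF mUF; rewrite /markov_msr.
under eq_fun do rewrite exchange_big/=.
apply: cvg_nnesum => i _.
  by near=> n; apply: sume_ge0 => k _; rewrite mule_ge0// lee_fin ltW.
under eq_fun do rewrite -ge0_sume_distrr//.
apply: cvgeZl => //; rewrite preimage_bigcup; apply: measure_semi_sigma_additive.
- by move=> n; exact: borel_preimage.
- apply/trivIsetP => j k _ _ jk; rewrite -preimage_setI.
  by move/trivIsetP : tF => /(_ _ _ _ _ jk) ->//; rewrite preimage_set0.
- by rewrite -preimage_bigcup; exact: borel_preimage.
Unshelve. all: by end_near. Qed.

HB.instance Definition _ := isMeasure.Build _ Y R markov_msr
  msr0 msr_ge0 msr_sigma_additive.

Let msr_finite : fin_num_fun markov_msr.
Proof.
move=> A mA; rewrite sum_fin_num; apply/allP => x /mapP[i _ ->].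
by apply: fin_numM => //; apply: fin_num_measure; exact: borel_preimage.
Qed.

HB.instance Definition _ := Measure_isFinite.Build _ Y R markov_msr msr_finite.

Lemma markov_msr_radon : radon m -> radon markov_msr.
Proof.
move=> mR B mB; apply/eqP; rewrite eq_le; apply/andP; split; last first.
  apply: ge_ereal_sup => _ [K [cK KB] <-].
  by apply: le_measure => //; rewrite inE//; exact: borel_compact.
apply/lee_addgt0Pr => e e0.
pose s := (\sum_(i < N) p i)%R.
have s0 : (0 <= s)%R by apply: sumr_ge0 => i _; exact: ltW.
pose d := (e / (s + 1))%R.
have d0 : (0 < d)%R by rewrite divr_gt0// ltr_wpDl.
have /choice[K KP] : forall i : 'I_N, exists K : set X,
    [/\ compact K, K `<=` (w i : X -> X) @^-1` B &
        m ((w i : Y -> Y) @^-1` B) <= m K + d%:E].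
  move=> i; have mwB := borel_preimage i mB.
  have fm : ereal_sup [set m C | C in [set C : set X | compact C /\
      C `<=` (w i : X -> X) @^-1` B]] \is a fin_num.
    by rewrite -(mR _ mwB) fin_num_measure.
  have [_ [K [cK KB] <-] h] := ub_ereal_sup_adherent d0 fm.
  by exists K; split=> //; rewrite (mR _ mwB) -leeBlDr// ltW.
pose L := \big[setU/set0]_(i < N) (w i @` K i).
have cL : compact L.
  apply: bigsetU_compact => i _; apply: continuous_compact; last by have [] := KP i.
  exact/continuous_subspaceT/w_cont.
have LB : L `<=` B.
  by rewrite /L -bigcup_seq => x [i _ [y Ky <-]]; have [_ + _] := KP i; exact.
have KL i : K i `<=` (w i : X -> X) @^-1` L.
  by move=> x Kx; rewrite /L /preimage/= -bigcup_seq; exists i; [rewrite /= mem_index_enum|exists x].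
apply: (@le_trans _ _ (markov_msr L + e%:E)); last first.
  by rewrite leeD2r//; apply: ereal_sup_ubound; exists L.
apply: (@le_trans _ _ (\sum_(i < N) ((p i)%:E * m ((w i : Y -> Y) @^-1` L) + (p i * d)%:E))).
  apply: lee_sum => i _; rewrite EFinM -ge0_muleDr ?lee_fin ?(ltW d0)//.
  apply: lee_wpmul2l; first by rewrite lee_fin ltW.
  have [cK _ /le_trans] := KP i; apply; rewrite leeD2r//.
  apply: le_measure; rewrite ?inE//; first exact: borel_compact.
  by apply: borel_preimage; exact: borel_compact.
rewrite big_split/= leeD2l// sumEFin lee_fin -mulr_suml -/s /d mulrCA.
by rewrite ler_piMr ?(ltW e0)// ler_pdivrMr ?ltr_wpDl// mul1r lerDl.
Qed.

End image_measure.

Lemma markov_out mu B : ~ measurable B -> markov_val mu B = 0.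
Proof. by move=> nB; rewrite /markov_val asboolF. Qed.

Lemma markov_diff (mu : signed_radon R X) :
  exists m1 m2 : {finite_measure set Y -> \bar R},
    [/\ radon m1, radon m2 &
        forall B, measurable B -> markov_val mu B = m1 B - m2 B].
Proof.
have [m1 [m2 [r1 r2 muE]]] := signed_radon_diff mu.
exists (markov_msr m1), (markov_msr m2); split; try exact: markov_msr_radon.
move=> B mB; rewrite /markov_val asboolT//= /markov_msr.
have fin (m : {finite_measure set Y -> \bar R}) i :
    (p i)%:E * m ((w i : Y -> Y) @^-1` B) \is a fin_num.
  by apply: fin_numM => //; apply: fin_num_measure; exact: borel_preimage.
rewrite -fin_num_sumeN// -big_split/=; apply: eq_bigr => i _.
have mwB := borel_preimage i mB.
by rewrite /pushforward muE// muleBr// fin_num_adde_defr// fin_num_measure.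
Qed.

Definition markov_operator (mu : signed_radon R X) : signed_radon R X :=
  SignedRadon (@markov_out mu) (markov_diff mu).

End markov_operator.

Section monge_kantorovich.
Context {R : realType} {X : completeMetricType R}.
Implicit Type mu nu : signed_radon R X.

Definition prob1 : set (signed_radon R X) := [set mu |
  exists P : probability (borelType X) R,
    [/\ mu = P :> (set (borelType X) -> \bar R), radon P &
        exists x0 : X, (\int[P]_x (mdist (x : X) x0)%:E < +oo)%E]].

(* [Rintegral] of the library, whose bundled measure argument rules out
   signed measures. *)
Definition sr_integral mu (f : X -> R) : R :=
  fine (\int[mu]_(x in [set: borelType X]) (f x)%:E)%E.

(* On [prob1] the set is nonempty and bounded above: if Lip(f) <= 1 then
   int f dmu - int f dnu <= int d(x,x0) dmu + int d(x,x0) dnu. *)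
Definition dMK mu nu : R :=
  sup [set sr_integral mu f - sr_integral nu f |
       f in [set f : X -> R | forall x y, `|f x - f y| <= mdist x y]].

Definition weak_cvg (mu_ : nat -> signed_radon R X) mu : Prop :=
  forall f : X -> R, bounded_fun f -> continuous f ->
    (fun n => sr_integral (mu_ n) f) @ \oo --> sr_integral mu f.

End monge_kantorovich.

(* Main.v *)
Require Import Defs.
From HB Require Import structures.
From mathcomp Require Import all_boot all_order all_algebra.
From mathcomp Require Import all_classical all_reals all_analysis.
From mathcomp Require Import measurable_realfun ring lra.

Set Implicit Arguments.
Unset Strict Implicit.
Unset Printing Implicit Defensive.
Import Order.TTheory GRing.Theory Num.Theory.
Import numFieldNormedType.Exports.

Local Open Scope classical_set_scope.
Local Open Scope ring_scope.

(* (b) For a 1-Lipschitz [f], the function [f \o w i] has modulus of continuity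
   [lambda t * t].  Replacing it by its [k]-Lipschitz envelope (inf-convolution
   with [k * d]), where [k = lambda s], changes it by at most [(1 - k) * s], so
   [dMK (M mu) (M nu) <= k * D + (1 - k) * s] with [D = dMK mu nu]; taking
   [s = D / 2] gives the rate [(1 + lambda (D / 2)) / 2] without any coupling.

   (c) No completeness of [prob1] is needed.  Cut [0, 1[ into cells of lengths
   [p j]; expanding the cells onto [0, 1[ gives each [t] a sequence of digits
   [j1 j2 ...], and [w j1 (w j2 (... x0))] converges uniformly in [t].  As Lebesgue
   measure is invariant under this digit scheme, the law of the limit is fixed by
   [M]; it is carried by a compact set, hence Radon and in [prob1].  By (b) the
   iterates of any [mu] approach it for [dMK].  Finally [dMK]-closeness controls
   the integrals of bounded lower semicontinuous functions from below through
   their Lipschitz envelopes: continuous functions and their opposites give weak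
   convergence, indicators of open sets give uniqueness. *)

(** * Lipschitz functions and their Lipschitz envelopes *)

Definition lip (R : realType) (X : metricType R) (k : R) (f : X -> R) :=
  forall x y, f x <= f y + k * mdist x y.

Section lipschitz.
Context {R : realType} {X : completeMetricType R}.
Implicit Types (f g : X -> R) (k m : R).
Local Notation Y := (borelType X).

Lemma lip1P f : lip 1 f <-> forall x y, `|f x - f y| <= mdist x y.
Proof.
split => [lf x y|lf x y]; last first.
  by have := lf x y; rewrite ler_norml => /andP[_]; lra.
by have := lf x y; have := lf y x; rewrite (metric_sym y) !mul1r ler_norml; lra.
Qed.

Lemma lip_continuous k f : lip k f -> continuous f.
Proof.
move=> lf x; apply/cvgrPdist_lt => e e0.
(* The constant [k] may vanish, while the radius [e / k'] needs a positive divisor. *)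
pose k' := Num.max k 1; have k'0 : 0 < k' by rewrite lt_max ltr01 orbT.
have lf' : lip k' f.
  move=> a b; apply: le_trans (lf a b) _; rewrite lerD2l ler_wpM2r ?mdist_ge0//.
  by rewrite le_max lexx.
have ek : 0 < e / k' by rewrite divr_gt0.
near=> y.
have : ball x (e / k') y by near: y; exact: nbhsx_ballx.
rewrite ballEmdist/= ltr_pdivlMr// mulrC => xy.
by have := lf' x y; have := lf' y x; rewrite (metric_sym y) ltr_norml; lra.
Unshelve. all: by end_near. Qed.

Lemma open_borel (U : set X) : open U -> measurable (U : set Y).
Proof. by move=> oU; exact: sub_sigma_algebra. Qed.

Lemma closed_borel (C : set X) : closed C -> measurable (C : set Y).
Proof.
move=> cC; rewrite -[C]setCK; apply: (@measurableC _ Y).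
by apply: open_borel; exact: closed_openC.
Qed.

Lemma continuous_borel f : continuous f -> measurable_fun [set: Y] (f : Y -> R).
Proof.
move=> /continuousP cf; apply: (measurability _ (RGenOInfty.measurableE R)).
move=> _ [_ [a ->] <-]; rewrite setTI; apply: open_borel.
by apply: cf; exact: interval_open.
Qed.

(** The Pasch-Hausdorff envelope: when the infimum is finite and [0 <= k], it is the largest
    [k]-Lipschitz minorant of [g]. *)
Definition lip_env k g x := inf [set g y + k * mdist x y | y in [set: X]].

Section lip_env.
Variables (k m : R) (g : X -> R).
Hypotheses (k0 : 0 <= k) (gm : forall x y, g x <= g y + k * mdist x y + m).

(** By [gm], [g] is [k]-Lipschitz up to the slack [m]. This keeps the infimum finite, and [m] also
    bounds what is lost in passing to the envelope. *)
Let env_lb x : has_lbound [set g y + k * mdist x y | y in [set: X]].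
Proof. by exists (g x - m) => _ [y _ <-]; have := gm x y; lra. Qed.

Lemma lip_env_le_at x y : lip_env k g x <= g y + k * mdist x y.
Proof. by apply: ge_inf => //; exists y. Qed.

Lemma lip_env_le x : lip_env k g x <= g x.
Proof. by have := lip_env_le_at x x; rewrite mdistxx mulr0 addr0. Qed.

Lemma lip_env_ge x c : (forall y, c <= g y + k * mdist x y) -> c <= lip_env k g x.
Proof.
move=> H; apply: lb_le_inf; first by exists (g x + k * mdist x x); exists x.
by move=> _ [y _ <-].
Qed.

Lemma lip_env_sub x : g x - m <= lip_env k g x.
Proof. by apply: lip_env_ge => y; have := gm x y; lra. Qed.

(** The envelope is an infimum of functions of [x] that are each [k]-Lipschitz by the triangle
    inequality. *)
Lemma lip_lip_env : lip k (lip_env k g).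
Proof.
move=> x y; rewrite -lerBlDr; apply: lip_env_ge => z.
have := lip_env_le_at x z; have := metric_triangle x y z.
by move=> /(ler_wpM2l k0); lra.
Qed.

End lip_env.

End lipschitz.

(** * Integrability of Lipschitz functions under a finite first moment *)

Section first_moment.
Context {R : realType} {X : completeMetricType R}.
Local Notation Y := (borelType X).

Definition integrable1 (P : {measure set Y -> \bar R}) :=
  exists x0 : X, (\int[P]_x (mdist (x : X) x0)%:E < +oo)%E.

Lemma mdist_lip (x0 : X) : lip 1 (fun x => mdist x x0).
Proof. by move=> x y; rewrite mul1r addrC; exact: metric_triangle. Qed.

Lemma lip_borel k (f : X -> R) : lip k f -> measurable_fun [set: Y] (f : Y -> R).
Proof. by move=> /lip_continuous/continuous_borel. Qed.

(** The growth bound [|f x0| + k * mdist x x0] is integrable, since the measure is finite and has a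
    first moment. *)
Lemma lip_integrable (P : {finite_measure set Y -> \bar R}) k (f : X -> R) :
  integrable1 P -> lip k f -> P.-integrable [set: Y] (EFin \o f).
Proof.
move=> [x0 Px0] lf.
have di : P.-integrable [set: Y] (EFin \o (fun x => mdist (x : X) x0)).
  apply/integrableP; split.
    by apply/measurable_EFinP; exact: lip_borel (mdist_lip x0).
  apply: le_lt_trans Px0; rewrite le_eqVlt; apply/orP; left; apply/eqP.
  by apply: eq_integral => x _ /=; rewrite ger0_norm// mdist_ge0.
have gi : P.-integrable [set: Y] (EFin \o (fun x => `|f x0| + k * mdist (x : X) x0)).
  rewrite (_ : _ \o _ = (EFin \o cst `|f x0|) \+
      (fun x => k%:E * (EFin \o (fun x => mdist (x : X) x0)) x)%E); last first.
    by apply/funext => x /=; rewrite EFinD EFinM.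
  apply: integrableD => //; last exact: integrableZl.
  exact: finite_measure_integrable_cst.
apply: le_integrable gi => //; first by apply/measurable_EFinP; exact: lip_borel lf.
move=> x _ /=; rewrite lee_fin (le_trans _ (ler_norm _))//.
have := lf x x0; have := lf x0 x; rewrite (metric_sym x0).
by have := ler_normlW (lexx `|f x0|); have := lerNnormlW (lexx `|f x0|);
  rewrite ler_norml; lra.
Qed.

End first_moment.

(** * Integrals of Lipschitz functions on [prob1] and basic bounds for [dMK] *)

Section integral_prob1.
Context {R : realType} {X : completeMetricType R}.
Local Notation Y := (borelType X).
Implicit Types (mu nu : signed_radon R X) (f g : X -> R).

Lemma sr_integralE mu (P : {measure set Y -> \bar R}) f :
  mu = P :> (set Y -> \bar R) -> sr_integral mu f = \int[P]_x f x.
Proof. by rewrite /sr_integral => ->. Qed.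

Lemma prob1P mu : prob1 mu -> exists P : probability Y R,
  [/\ mu = P :> (set Y -> \bar R), radon P & integrable1 P].
Proof. by move=> [P [muP rP iP]]; exists P. Qed.

Lemma le_sr_integral_lip mu k l f g : prob1 mu -> lip k f -> lip l g ->
  (forall x, f x <= g x) -> sr_integral mu f <= sr_integral mu g.
Proof.
move=> /prob1P[P [muP _ iP]] lf lg fg; rewrite !(sr_integralE _ muP).
by apply: le_Rintegral => //; exact: lip_integrable.
Qed.

Lemma sr_integralZ_lip mu k f c : prob1 mu -> lip k f ->
  sr_integral mu (fun x => c * f x) = c * sr_integral mu f.
Proof.
move=> /prob1P[P [muP _ iP]] lf; rewrite !(sr_integralE _ muP).
by rewrite RintegralZl//; exact: lip_integrable lf.
Qed.

Lemma sr_integralD_cst mu k f c : prob1 mu -> lip k f ->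
  sr_integral mu (fun x => f x + c) = sr_integral mu f + c.
Proof.
move=> /prob1P[P [muP _ iP]] lf; rewrite !(sr_integralE _ muP).
rewrite RintegralD//; [|exact: lip_integrable lf|exact: finite_measure_integrable_cst].
by congr (_ + _); rewrite Rintegral_cst//= [X in fine X](@probability_setT _ _ _ P) mulr1.
Qed.

(** A 1-Lipschitz [f] lies between the cones [f x0 - mdist x x0] and [f x0 + mdist x x0]; as both
    masses are 1, the two terms [f x0] cancel. *)
Lemma dMK_has_ubound mu nu : prob1 mu -> prob1 nu ->
  has_ubound [set sr_integral mu f - sr_integral nu f |
       f in [set f : X -> R | forall x y, `|f x - f y| <= mdist x y]].
Proof.
move=> pmu pnu; pose x0 : X := point.
exists (sr_integral mu (fun x => mdist x x0) + sr_integral nu (fun x => mdist x x0)).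
move=> _ [f /lip1P lf <-].
have h1 : sr_integral mu f <= sr_integral mu (fun x => mdist x x0) + f x0.
  rewrite -(sr_integralD_cst _ pmu (mdist_lip x0)).
  have l : lip 1 (fun x => mdist x x0 + f x0).
    by move=> x y; have := mdist_lip x0 x y; lra.
  by apply: (le_sr_integral_lip pmu lf l) => x; rewrite addrC; have := lf x x0; lra.
have h2 : - sr_integral nu (fun x => mdist x x0) + f x0 <= sr_integral nu f.
  rewrite -[X in X + _]mulN1r -(sr_integralZ_lip _ pnu (mdist_lip x0)).
  have l : lip 1 (fun x => -1 * mdist x x0).
    by move=> x y; have := mdist_lip x0 y x; rewrite (metric_sym y x); lra.
  rewrite -(sr_integralD_cst _ pnu l).
  have l' : lip 1 (fun x => -1 * mdist x x0 + f x0).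
    by move=> x y; have := l x y; lra.
  apply: (le_sr_integral_lip pnu l' lf) => x.
  by have := lf x0 x; rewrite (metric_sym x0); lra.
lra.
Qed.

(** Dividing [f] by [k] makes it an admissible test function. *)
Lemma lip_dMK mu nu k f : prob1 mu -> prob1 nu -> 0 < k -> lip k f ->
  sr_integral mu f - sr_integral nu f <= k * dMK mu nu.
Proof.
move=> pmu pnu k0 lf; rewrite mulrC -ler_pdivrMr// mulrC mulrBr.
rewrite -!(sr_integralZ_lip _ _ lf)//.
apply: ub_le_sup; first exact: dMK_has_ubound.
exists (fun x => k^-1 * f x) => //; apply/lip1P => x y.
by rewrite mul1r -(ler_pM2l k0) mulrDr !mulrA divff ?gt_eqF// !mul1r; exact: lf.
Qed.

Lemma dMK_le mu nu c :
  (forall f, lip 1 f -> sr_integral mu f - sr_integral nu f <= c) -> dMK mu nu <= c.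
Proof.
move=> H; apply: ge_sup; last by move=> _ [f /lip1P lf <-]; exact: H.
(* The bound on the supremum needs a nonempty set; the zero function is admissible. *)
exists (sr_integral mu (cst 0) - sr_integral nu (cst 0)), (cst 0) => //= x y.
by rewrite subrr normr0 mdist_ge0.
Qed.

Lemma dMK_ge0 mu nu : prob1 mu -> prob1 nu -> 0 <= dMK mu nu.
Proof.
move=> pmu pnu; have l0 : @lip R X 1 (fun=> 0).
  by move=> x y /=; rewrite add0r mul1r mdist_ge0.
apply: le_trans (ub_le_sup (dMK_has_ubound pmu pnu) _); last first.
  (* The zero function is written as a multiple by 0, so that homogeneity evaluates its
     integrals. *)
  by exists (fun x : X => 0 * 0) => //= x y; rewrite subrr normr0 mdist_ge0.
by rewrite !(sr_integralZ_lip _ _ l0)// !mul0r subrr.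
Qed.

End integral_prob1.

(** * Passage between bundled measures and signed Radon measures *)

Section restrict_measurable.
Context d (T : measurableType d) (R : realType).
Variable m : {measure set T -> \bar R}.
Local Open Scope ereal_scope.

(* [signed_radon] demands the value 0 off the measurable sets. *)
Definition mmeasurable (B : set T) := if `[< measurable B >] then m B else 0.

Lemma mmeasurableE B : measurable B -> mmeasurable B = m B.
Proof. by move=> mB; rewrite /mmeasurable asboolT. Qed.

Let mm0 : mmeasurable set0 = 0.
Proof. by rewrite mmeasurableE. Qed.

Let mm_ge0 B : 0 <= mmeasurable B.
Proof. by rewrite /mmeasurable; case: ifP. Qed.

Let mm_sigma_additive : semi_sigma_additive mmeasurable.
Proof.
move=> F mF tF mUF; rewrite mmeasurableE//.
under eq_fun do under eq_bigr do rewrite mmeasurableE//.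
exact: measure_semi_sigma_additive.
Qed.

HB.instance Definition _ := isMeasure.Build _ T R mmeasurable
  mm0 mm_ge0 mm_sigma_additive.

Section probability.
Hypothesis m1 : m [set: T] = 1.

Let mm1 : mmeasurable [set: T] = 1.
Proof. by rewrite mmeasurableE. Qed.

HB.instance Definition _ := Measure_isProbability.Build _ T R mmeasurable mm1.

Definition pmeasurable : probability T R := mmeasurable.

End probability.

End restrict_measurable.

Section signed_radon_measures.
Context {R : realType} {X : completeMetricType R}.
Local Notation Y := (borelType X).
Local Open Scope ereal_scope.
Implicit Types (m : {finite_measure set Y -> \bar R}) (mu nu : signed_radon R X).

Lemma compact_borel (K : set X) : compact K -> measurable (K : set Y).
Proof.
by move=> cK; apply: closed_borel; exact: compact_closed (@metric_hausdorff _ X) cK.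
Qed.

(** Compact sets are Borel here, so the suprema over compact subsets agree too. *)
Lemma eq_radon (m1 m2 : set Y -> \bar R) :
  (forall B, measurable B -> m1 B = m2 B) -> radon m1 -> radon m2.
Proof.
move=> m12 r1 B mB; rewrite -m12// (r1 _ mB); congr ereal_sup.
by apply/seteqP; split=> _ [K [cK KB] <-]; exists K => //;
  rewrite m12//; exact: compact_borel.
Qed.

(** Off the Borel sets both values are 0, and the remaining fields are proofs, identified by proof
    irrelevance. *)
Lemma signed_radon_ext mu nu :
  (forall B, measurable B -> mu B = nu B) -> mu = nu.
Proof.
move=> munu; have {munu} : mu = nu :> (set Y -> \bar R).
  apply/funext => B; have [|nB] := pselect (measurable B); first exact: munu.
  by rewrite !signed_radon_out.
case: mu nu => [f fo fd] [g go gd] /= fg; subst g.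
by rewrite (Prop_irrelevance fo go) (Prop_irrelevance fd gd).
Qed.

Lemma radon_mzero : radon (mzero : set Y -> \bar R).
Proof.
move=> B mB; rewrite (_ : [set _ | _ in _] = [set 0]) ?ereal_sup1//.
apply/seteqP; split=> [_ [K _ <-]//|_ ->]; exists set0 => //; split => //.
exact: compact0.
Qed.

Lemma signed_radon_exists m : radon m ->
  exists mu, forall B, measurable B -> mu B = m B.
Proof.
move=> rm.
have out B : ~ measurable B -> mmeasurable m B = 0.
  by move=> nB; rewrite /mmeasurable asboolF.
have diff : exists m1 m2 : {finite_measure set Y -> \bar R},
    [/\ radon m1, radon m2 &
        forall B, measurable B -> mmeasurable m B = m1 B - m2 B].
  exists m, mzero; split => //; first exact: radon_mzero.
  by move=> B mB; rewrite mmeasurableE// sube0.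
by exists (SignedRadon out diff) => B mB /=; rewrite mmeasurableE.
Qed.

(** [prob1] asks for equality with a probability on all sets, so the witness is [m] cut to 0 off the
    Borel sets. *)
Lemma eq_prob1 m mu : (forall B, measurable B -> mu B = m B) ->
  m [set: Y] = 1 -> radon m -> integrable1 m -> prob1 mu.
Proof.
move=> mum m1 rm [x0 im]; exists (pmeasurable m1); split.
- apply/funext => B; have [mB|nB] := pselect (measurable B).
    by rewrite mum//= mmeasurableE.
  by rewrite signed_radon_out//= /mmeasurable asboolF.
- by apply: eq_radon rm => B mB /=; rewrite mmeasurableE.
- exists x0; rewrite (eq_measure_integral m)// => A mA _ /=.
  by rewrite mmeasurableE.
Qed.

End signed_radon_measures.

(** * Change of variables for the Markov operator *)

Section markov_integral.
Context {R : realType} {X : completeMetricType R} {N : nat}.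
Variables (w : 'I_N -> X -> X) (p : 'I_N -> R).
Local Notation Y := (borelType X).
Hypotheses (w_cont : forall i, continuous (w i)) (p_gt0 : forall i, (0 < p i)%R).
Variable P : {finite_measure set Y -> \bar R}.
Local Open Scope ereal_scope.

Lemma continuous_borel_fun (f : X -> X) :
  continuous f -> measurable_fun [set: Y] (f : Y -> Y).
Proof.
move=> /continuousP cf; apply: (@measurability _ _ Y Y _ _ (@open X)) => //.
by move=> _ [A oA <-]; rewrite setTI; apply: open_borel; exact: cf.
Qed.

Definition markov_measure : {finite_measure set Y -> \bar R} :=
  Defs_markov_msr__canonical__measure_function_FiniteMeasure w_cont p_gt0 P.

Let wm i := continuous_borel_fun (@w_cont i).

(** The measure is a finite sum of scaled push-forwards, and the integral is additive and
    homogeneous in the measure. *)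
Lemma ge0_integral_markov (f : Y -> \bar R) :
  measurable_fun [set: Y] f -> (forall x, 0 <= f x) ->
  \int[markov_measure]_x f x = \sum_(i < N) (p i)%:E * \int[P]_x f (w i x).
Proof.
move=> mf f0.
pose pf i := measure_function_pushforward__canonical__measure_function_Measure P (wm i).
(* [msum] takes a sequence indexed by [nat]; indices from [N] on get the default [mzero], outside
   the range of the sum. *)
pose m_ (k : nat) : {measure set Y -> \bar R} :=
  oapp (fun i : 'I_N => mscale (NngNum (ltW (p_gt0 i))) (pf i) : {measure set Y -> \bar R})
    mzero (insub k).
rewrite (eq_measure_integral (msum m_ N)); last first.
  move=> A mA _; rewrite /= /markov_msr /msum; apply: eq_bigr => i _.
  by rewrite /m_ valK.
rewrite ge0_integral_measure_sum//; apply: eq_bigr => i _.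
rewrite /m_ valK /= ge0_integral_mscale//= ge0_integral_pushforward//.
Qed.

(** Positive and negative parts are transported separately; integrability of each [f \o w i] keeps
    their differences well defined in the extended reals. *)
Lemma integral_markov (f : Y -> R) : measurable_fun [set: Y] f ->
  (forall i, P.-integrable [set: Y] (EFin \o (f \o w i))) ->
  \int[markov_measure]_x (f x)%:E = \sum_(i < N) (p i)%:E * \int[P]_x (f (w i x))%:E.
Proof.
move=> mf fi; have mf' : measurable_fun [set: Y] (EFin \o f) by apply/measurable_EFinP.
rewrite integralE !ge0_integral_markov//; last 2 first.
  exact: measurable_funeneg.
  exact: measurable_funepos.
have pos i : \int[P]_x (EFin \o f)^\+ (w i x) \is a fin_num.
  have := integrable_pos_fin_num measurableT (fi i).
  by rewrite (funepos_comp (EFin \o f) (w i)).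
have neg i : \int[P]_x (EFin \o f)^\- (w i x) \is a fin_num.
  have := integrable_neg_fin_num measurableT (fi i).
  by rewrite (funeneg_comp (EFin \o f) (w i)).
rewrite -fin_num_sumeN; last by move=> i _; exact: fin_numM.
rewrite -big_split/=; apply: eq_bigr => i _.
rewrite -muleBr//; last exact: fin_num_adde_defr.
congr (_ * _); rewrite [RHS]integralE.
by rewrite (funepos_comp (EFin \o f) (w i)) (funeneg_comp (EFin \o f) (w i)).
Qed.

Hypothesis w_lip : forall i x y, (mdist (w i x) (w i y) <= mdist x y)%R.

Lemma lip_comp k (f : X -> R) i : (0 <= k)%R -> lip k f -> lip k (f \o w i).
Proof.
move=> k0 lf x y; apply: le_trans (lf _ (w i y)) _.
by rewrite /= lerD2l ler_wpM2l.
Qed.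

(** As [w i] is nonexpansive, the distance from [w i x] to [x0] is 1-Lipschitz in [x], hence
    [P]-integrable. *)
Lemma markov_integrable1 : integrable1 P -> integrable1 markov_measure.
Proof.
move=> iP; pose x0 : X := point; exists x0.
rewrite (@ge0_integral_markov (fun x => (mdist (x : X) x0)%:E)); first last.
- by move=> x; rewrite lee_fin mdist_ge0.
- by apply/measurable_EFinP; exact: lip_borel (mdist_lip x0).
apply: lte_sum_pinfty => i _; apply: lte_mul_pinfty; rewrite ?lee_fin ?ltW//.
have := lip_integrable iP (lip_comp i ler01 (mdist_lip x0)).
by move=> /integrable_lty; apply.
Qed.

Lemma Rintegral_markov k (f : X -> R) : integrable1 P -> (0 <= k)%R -> lip k f ->
  (\int[markov_measure]_x f x = \sum_(i < N) p i * \int[P]_x f (w i x))%R.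
Proof.
move=> iP k0 lf; have fi i := lip_integrable iP (lip_comp i k0 lf).
rewrite /Rintegral integral_markov//; last exact: lip_borel lf.
rewrite (eq_bigr (fun i => (p i * \int[P]_x f (w i x))%:E)) ?sumEFin// => i _.
by rewrite EFinM /Rintegral fineK//; exact: (integrable_fin_num _ (fi i)).
Qed.

End markov_integral.

Section markov_operator.
Context {R : realType} {X : completeMetricType R} {N : nat}.
Variables (w : 'I_N -> X -> X) (p : 'I_N -> R).
Local Notation Y := (borelType X).
Hypotheses (w_cont : forall i, continuous (w i)) (p_gt0 : forall i, 0 < p i).
Hypothesis p_sum1 : \sum_(i < N) p i = 1.
Hypothesis w_lip : forall i x y, mdist (w i x) (w i y) <= mdist x y.
Local Notation M := (markov_operator w_cont p_gt0).
Implicit Types mu nu : signed_radon R X.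

Lemma markov_operatorE mu (P : {finite_measure set Y -> \bar R}) B :
  (forall A, measurable A -> mu A = P A) -> measurable B ->
  M mu B = markov_measure w_cont p_gt0 P B.
Proof.
move=> muP mB /=; rewrite /markov_val asboolT//= /markov_msr.
apply: eq_bigr => i _; rewrite /pushforward muP// -[X in measurable X]setTI.
by apply: (continuous_borel_fun (@w_cont i)).
Qed.

Lemma prob1_markov mu : prob1 mu -> prob1 (M mu).
Proof.
move=> /prob1P[P [muP rP iP]].
apply: (@eq_prob1 _ _ (markov_measure w_cont p_gt0 P)).
- by move=> B mB; apply: markov_operatorE => // A _; rewrite muP.
- rewrite /= /markov_msr.
  under eq_bigr do rewrite preimage_setT [X in (_ * X)%E](@probability_setT _ _ _ P) mule1.
  by rewrite sumEFin p_sum1.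
- exact: markov_msr_radon.
- exact: markov_integrable1.
Qed.

(** Duality: bounds on [M mu] become bounds on [mu] tested against the functions [f \o w i]. *)
Lemma sr_integral_markov mu k f : prob1 mu -> 0 <= k -> lip k f ->
  sr_integral (M mu) f = \sum_(i < N) p i * sr_integral mu (f \o w i).
Proof.
move=> /prob1P[P [muP rP iP]] k0 lf.
rewrite /sr_integral; have [Q [MQ _ _]] := prob1P (prob1_markov (ex_intro _ P (And3 muP rP iP))).
(* [Q] and the bundled image measure are compared on Borel sets only, which determine the
   integral. *)
rewrite MQ (eq_measure_integral (markov_measure w_cont p_gt0 P)); last first.
  move=> A mA _; transitivity (M mu A); first by rewrite MQ.
  by apply: markov_operatorE => // B _; rewrite muP.
rewrite -[LHS]/(Rintegral _ _ _) (Rintegral_markov _ _ _ iP k0 lf)//.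
by apply: eq_bigr => i _; rewrite muP.
Qed.

End markov_operator.

(** * A common rate for finitely many Rakotch contractions *)

Section rakotch_rate.
Context {R : realType} {X : metricType R} {N : nat}.
Variable w : 'I_N -> X -> X.

(** Positivity is demanded because values of [lambda] later serve as Lipschitz constants in
    [lip_dMK], where one divides by them. *)
Definition common_rate (lambda : R -> R) :=
  [/\ forall t, 0 <= t -> 0 < lambda t <= 1,
      forall s t, 0 <= s -> s <= t -> lambda t <= lambda s,
      forall t, 0 < t -> lambda t < 1 &
      forall i x y, mdist (w i x) (w i y) <= lambda (mdist x y) * mdist x y].

(** The maximum of the individual rates and [1 / 2]: the floor gives positivity, and a finite
    maximum of numbers below 1 stays below 1. *)
Lemma rakotch_common_rate :
  (forall i, rakotch_contraction (@mdist R X) [set: X] (w i)) ->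
  exists lambda, common_rate lambda.
Proof.
move=> wr; have /choice[l lP] i := (wr i).2.
have half1 : (2^-1 : R) < 1 by lra.
exists (fun t => \big[Num.max/2^-1]_(i < N) l i t); split.
- move=> t t0; apply/andP; split.
    by apply: lt_le_trans (bigmax_ge_id _ _ _ _); lra.
  by apply: bigmax_le; [lra|move=> i _; have [/(_ _ t0)/andP[]] := lP i].
- move=> s t s0 st; apply: bigmax_le; first exact: bigmax_ge_id.
  move=> i _; have [_ /(_ _ _ s0 st) h _ _] := lP i.
  by apply: le_trans h _; exact: le_bigmax.
- move=> t t0; apply: bigmax_lt => // i _.
  by have [_ _ /(_ _ t0)] := lP i.
- move=> i x y; have [_ _ _ /(_ x y I I) h] := lP i.
  apply: le_trans h _; apply: ler_wpM2r; first exact: mdist_ge0.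
  exact: le_bigmax.
Qed.

Lemma common_rate_lip lambda : common_rate lambda ->
  forall i x y, mdist (w i x) (w i y) <= mdist x y.
Proof.
move=> [l01 _ _ lw] i x y; apply: le_trans (lw i x y) _.
by rewrite ler_piMl ?mdist_ge0//; case/andP: (l01 _ (mdist_ge0 x y)).
Qed.

End rakotch_rate.

(** * The Markov operator is a Rakotch contraction for [dMK] *)

Section markov_contraction.
Context {R : realType} {X : completeMetricType R} {N : nat}.
Variables (w : 'I_N -> X -> X) (p : 'I_N -> R).
Hypotheses (w_cont : forall i, continuous (w i)) (p_gt0 : forall i, 0 < p i).
Hypothesis p_sum1 : \sum_(i < N) p i = 1.
Local Notation M := (markov_operator w_cont p_gt0).

(* Below distance [s] the modulus [lambda t * t] exceeds the line [lambda s * t]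
   by at most [(1 - lambda s) * s], and above [s] it stays under that line; so
   replacing [f \o w i] by its [lambda s]-Lipschitz envelope costs no more. *)
Lemma markov_dMK_rate lambda : common_rate w lambda ->
  forall mu nu : signed_radon R X, prob1 mu -> prob1 nu ->
  dMK (M mu) (M nu) <= (1 + lambda (dMK mu nu / 2)) / 2 * dMK mu nu.
Proof.
move=> lr mu nu pmu pnu; have w_lip := common_rate_lip lr.
have [l01 ldec l1 lw] := lr.
set D := dMK mu nu; have D0 : 0 <= D by exact: dMK_ge0.
apply: dMK_le => f lf.
rewrite !(sr_integral_markov _ _ _ _ _ ler01 lf)// -sumrB.
(* The weights sum to 1, so it suffices to bound the difference for each [i] by [c]. *)
set c := _ * D; rewrite -[c]mul1r -p_sum1 mulr_suml; apply: ler_sum => i _.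
rewrite -mulrBr ler_pM2l//.
have lg : lip 1 (f \o w i) by exact: lip_comp.
have [D00|Dn0] := eqVneq D 0.
  by rewrite /c D00 mulr0 -[leRHS](mulr0 1) -D00; exact: lip_dMK.
have Dgt : 0 < D by rewrite lt_neqAle eq_sym Dn0.
pose s := D / 2; have s0 : 0 < s by rewrite /s; lra.
pose k := lambda s; have /andP[k0 k1] : 0 < k <= 1 := l01 _ (ltW s0).
pose m := (1 - k) * s.
have gm x y : (f \o w i) x <= (f \o w i) y + k * mdist x y + m.
  have := lf (w i x) (w i y); rewrite mul1r /= => /le_trans; apply.
  rewrite -addrA lerD2l; apply: le_trans (lw i x y) _.
  have t0 := mdist_ge0 x y; set t := mdist x y in t0 *.
  have m0 : 0 <= m by rewrite /m mulr_ge0//; lra.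
  have [st|ts] := leP s t.
    have : lambda t * t <= k * t by rewrite ler_wpM2r//; apply: ldec => //; exact: ltW.
    lra.
  have : lambda t * t <= t by rewrite ler_piMl//; case/andP: (l01 _ t0).
  have : (1 - k) * t <= m by apply: ler_wpM2l; [lra|exact: ltW].
  lra.
pose h := lip_env k (f \o w i).
have lh : lip k h := lip_lip_env (ltW k0) gm.
have lhm : lip k (fun x => h x + m) by move=> x y; have := lh x y; lra.
have h1 : sr_integral mu (f \o w i) <= sr_integral mu h + m.
  rewrite -(sr_integralD_cst _ pmu lh); apply: (le_sr_integral_lip pmu lg lhm) => x.
  by have := lip_env_sub gm x; rewrite -/h; lra.
have h2 : sr_integral nu h <= sr_integral nu (f \o w i).
  by apply: (le_sr_integral_lip pnu lh lg) => x; exact: (lip_env_le gm).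
have h3 := lip_dMK pmu pnu k0 lh.
(* With [s = D / 2], [(1 - k) * s + k * D] is [(1 + k) / 2 * D]. *)
have -> : c = m + k * D by rewrite /c /m -/s -/k /s; field.
by rewrite -/D in h3; lra.
Qed.

Lemma markov_rakotch :
  (forall i, rakotch_contraction (@mdist R X) [set: X] (w i)) ->
  rakotch_contraction dMK prob1 M.
Proof.
move=> /rakotch_common_rate[l lr]; have [l01 ldec l1 _] := lr.
split; first by move=> mu; apply: prob1_markov => //; exact: common_rate_lip lr.
have half (t : R) : 0 <= t -> 0 <= t / 2 by move=> t0; rewrite divr_ge0.
exists (fun t => (1 + l (t / 2)) / 2); split; last exact: markov_dMK_rate.
- by move=> t /half/l01; lra.
- move=> s t s0 st; have := ldec (s / 2) (t / 2) (half _ s0).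
  by rewrite ler_pM2r ?invr_gt0// => /(_ st); lra.
- by move=> t t0; have := l1 (t / 2); rewrite divr_gt0// => /(_ isT); lra.
Qed.

End markov_contraction.

(** * From [dMK] to weak convergence and equality of measures *)

Section weak_convergence.
Context {R : realType} {X : completeMetricType R}.
Local Notation Y := (borelType X).
Implicit Types (mu nu : signed_radon R X) (f g : X -> R).

Definition lsc g := forall x e, 0 < e ->
  exists2 d, 0 < d & forall y, mdist x y < d -> g x - e < g y.

Lemma continuous_lsc g : continuous g -> lsc g.
Proof.
move=> cg x e e0; have /cvgrPdist_lt/(_ _ e0) := cg x.
move=> /nbhs_ballP[d d0 H]; exists d => // y xy.
have /H/= : ball x d y by rewrite ballEmdist.
by rewrite ltr_norml; lra.
Qed.

Lemma bounded_integrable (P : {finite_measure set Y -> \bar R}) (g : Y -> R) B :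
  measurable_fun [set: Y] g -> (forall x, `|g x| <= B) ->
  P.-integrable [set: Y] (EFin \o g).
Proof.
move=> mg gB; apply: (le_integrable _ _ _ (finite_measure_integrable_cst P B measurableT)) => //.
  exact/measurable_EFinP.
by move=> x _ /=; rewrite lee_fin (le_trans (gB x))// ler_norm.
Qed.

Lemma le_sr_integral_bounded mu f g B : prob1 mu ->
  measurable_fun [set: Y] (f : Y -> R) -> measurable_fun [set: Y] (g : Y -> R) ->
  (forall x, `|f x| <= B) -> (forall x, `|g x| <= B) ->
  (forall x, f x <= g x) -> sr_integral mu f <= sr_integral mu g.
Proof.
move=> /prob1P[P [muP _ iP]] mf mg fB gB fg; rewrite !(sr_integralE _ muP).
by apply: le_Rintegral => //; [exact: bounded_integrable fB|exact: bounded_integrable gB].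
Qed.

(* The [n]-Lipschitz envelopes increase to [g], and the integrals of each of
   them are controlled by [dMK]. *)
Lemma lsc_dMK mu g B e : prob1 mu -> measurable_fun [set: Y] (g : Y -> R) ->
  (forall x, `|g x| <= B) -> lsc g -> 0 < e ->
  exists2 d, 0 < d & forall nu, prob1 nu -> dMK mu nu < d ->
    sr_integral mu g - e <= sr_integral nu g.
Proof.
move=> pmu mg gB lg e0.
have gB' x : - B <= g x <= B by rewrite -ler_norml.
pose k n : R := n.+1%:R; have k0 n : 0 < k n by rewrite ltr0Sn.
(* The oscillation [2 * B] serves as slack for every Lipschitz constant. *)
have gm n x y : g x <= g y + k n * mdist x y + 2 * B.
  have := gB' x; have := gB' y.
  by have := mulr_ge0 (ltW (k0 n)) (mdist_ge0 x y); lra.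
pose h n := lip_env (k n) g.
have lh n : lip (k n) (h n) := lip_lip_env (ltW (k0 n)) (gm n).
have mh n : measurable_fun [set: Y] (h n : Y -> R) := lip_borel (lh n).
have hg n x : h n x <= g x := lip_env_le (gm n) x.
have hB n x : `|h n x| <= B.
  rewrite ler_norml (le_trans (hg n x)) ?andbT; last by have := gB' x; lra.
  apply: lip_env_ge => y; have := gB' y.
  by have := mulr_ge0 (ltW (k0 n)) (mdist_ge0 x y); lra.
(* For [y] within [d] of [x], lower semicontinuity bounds [g y] below; farther off, the penalty
   [k n * mdist x y] is at least [2 * B] once [n >= 2 * B / d]. *)
have hcvg x : h ^~ x @ \oo --> g x.
  apply/cvgrPdist_le => r r0; have [d d0 dP] := lg x _ r0.
  near=> n; rewrite ger0_norm ?subr_ge0//; suff : g x - r <= h n x by lra.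
  apply: lip_env_ge => y; have [xy|xy] := ltP (mdist x y) d.
    have := dP _ xy; have := mulr_ge0 (ltW (k0 n)) (mdist_ge0 x y); lra.
  have : 2 * B <= k n * mdist x y.
    apply: (@le_trans _ _ (k n * d)); last by rewrite ler_pM2l.
    rewrite -ler_pdivrMr//; apply: (@le_trans _ _ n%:R); last by rewrite ler_nat.
    by near: n; exact: nbhs_infty_ger.
  by have := gB' x; have := gB' y; lra.
have [P [muP _ iP]] := prob1P pmu.
have cv : (fun n => \int[P]_x (h n x)%:E)%E @ \oo --> (\int[P]_x (g x)%:E)%E.
  have [//| | | | |_ _] := @dominated_convergence _ _ _ P _ measurableT
    (fun n x => (h n x)%:E) (EFin \o g) (EFin \o cst B) _ _ _ _ _.
  - by move=> n; apply/measurable_EFinP; exact: mh.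
  - exact/measurable_EFinP.
  - by apply: aeW => x _; apply/fine_cvgP; split; [exact: nearW|exact: hcvg].
  - exact: finite_measure_integrable_cst.
  - by apply: aeW => x n _; rewrite lee_fin.
  - exact.
have {}cv : (fun n => sr_integral mu (h n)) @ \oo --> sr_integral mu g.
  rewrite /sr_integral muP; apply: fine_cvg; rewrite fineK//.
  apply: (integrable_fin_num measurableT (bounded_integrable P mg gB)).
(* One envelope with integral within [e / 2] of that of [g] is fixed; its Lipschitz constant then
   dictates the radius for [dMK]. *)
have /cvgrPdist_lt/(_ (e / 2))[|n _ /(_ n (leqnn n))/= nP] := cv; first lra.
exists (e / 2 / k n) => [|nu pnu dmn]; first by rewrite !divr_gt0.
have := lip_dMK pmu pnu (k0 n) (lh n).
have : k n * dMK mu nu < e / 2 by rewrite mulrC -ltr_pdivlMr.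
have := le_sr_integral_bounded pnu (mh n) mg (hB n) gB (hg n).
by move: nP; rewrite ltr_norml; lra.
Unshelve. all: by end_near. Qed.

Lemma dMK_weak_cvg (mu_ : nat -> signed_radon R X) mu : prob1 mu ->
  (forall n, prob1 (mu_ n)) -> (fun n => dMK mu (mu_ n)) @ \oo --> 0 ->
  weak_cvg mu_ mu.
Proof.
move=> pmu pmu_ cv f [B0 [_ Bf]] cf.
(* [bounded_fun] provides the constants strictly above [B0], not [B0] itself. *)
pose B := B0 + 1; have fB x : `|f x| <= B by apply: Bf => //; rewrite ltrDl.
have mf := continuous_borel cf.
have half g : measurable_fun [set: Y] (g : Y -> R) -> (forall x, `|g x| <= B) ->
    lsc g -> forall e, 0 < e ->
    \forall n \near \oo, sr_integral mu g - e <= sr_integral (mu_ n) g.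
  move=> mg gB lg e e0; have [d d0 dP] := lsc_dMK pmu mg gB lg e0.
  move/cvgrPdist_lt : cv => /(_ _ d0); apply: filterS => n.
  by rewrite sub0r normrN ltr_norml => /andP[_ ?]; exact: dP.
have cNf : continuous (fun x => - f x) by move=> x; exact: cvgN (cf x).
have Nint (nu : signed_radon R X) : prob1 nu -> sr_integral nu (fun x => - f x) = - sr_integral nu f.
  move=> /prob1P[P [nuP _ _]]; rewrite !(sr_integralE _ nuP).
  under eq_Rintegral do rewrite -mulN1r.
  by rewrite RintegralZl ?mulN1r//; exact: bounded_integrable fB.
apply/cvgrPdist_le => e e0.
have h1 := half f mf fB (continuous_lsc cf) _ e0.
have h2 := half (fun x => - f x) (continuous_borel cNf) _ (continuous_lsc cNf) _ e0.
near=> n.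
have : sr_integral mu f - e <= sr_integral (mu_ n) f by near: n.
have : sr_integral mu (fun x => - f x) - e <= sr_integral (mu_ n) (fun x => - f x).
  by near: n; apply: h2 => x; rewrite normrN.
by rewrite (Nint _ pmu) (Nint _ (pmu_ n)) ler_norml; lra.
Unshelve. all: by end_near. Qed.

(** Near a point of [U] the indicator is constant; elsewhere it takes its minimum 0. *)
Lemma open_indic_lsc (U : set X) : open U -> lsc (\1_U : X -> R).
Proof.
move=> oU x e e0; have [xU|xU] := pselect (U x).
  have /nbhs_ballP[d d0 dU] : nbhs x U by exact: open_nbhs_nbhs.
  exists d => // y xy; rewrite !indicE !mem_set//; first lra.
  by apply: dU; rewrite ballEmdist.
by exists 1 => // y _; rewrite !indicE (memNset xU); case: (_ \in _) => /=; lra.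
Qed.

(** [lsc_dMK] on indicators of open sets, in both directions, equates the measures of open sets, a
    class stable under intersection that generates the Borel sets. *)
Lemma dMK_eq0 mu nu : prob1 mu -> prob1 nu -> dMK mu nu = 0 -> dMK nu mu = 0 ->
  mu = nu.
Proof.
move=> pmu pnu d0 d0'.
have le_open (m1 m2 : signed_radon R X) (P1 P2 : probability Y R) U :
    prob1 m1 -> prob1 m2 -> m1 = P1 :> (set Y -> \bar R) ->
    m2 = P2 :> (set Y -> \bar R) ->
    dMK m1 m2 = 0 -> open U -> (P1 U <= P2 U)%E.
  move=> p1 p2 E1 E2 d oU; have mU := open_borel oU.
  have intE (P : probability Y R) : \int[P]_x (\1_U x : R) = fine (P U).
    by rewrite /Rintegral integral_indic// setIT.
  rewrite -(fineK (fin_num_measure P1 _ mU)) -(fineK (fin_num_measure P2 _ mU)) lee_fin.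
  apply/ler_addgt0Pr => e e0; rewrite -!intE -(sr_integralE _ E1) -(sr_integralE _ E2).
  have U1 x : `|\1_U x : R| <= 1.
    by rewrite indicE; case: (_ \in _); rewrite /= ?normr1 ?normr0.
  have [r r0 rP] := lsc_dMK p1 (measurable_indic mU) U1 (open_indic_lsc oU) e0.
  by have := rP _ p2; rewrite d => /(_ r0); lra.
have [P [muP _ _]] := prob1P pmu; have [Q [nuQ _ _]] := prob1P pnu.
apply: signed_radon_ext => B mB; rewrite muP nuQ.
apply: (@measure_unique _ _ Y (@open X) (fun=> setT) erefl) => //.
- by move=> A C; exact: openI.
- by move=> _; exact: openT.
- by apply/seteqP; split => // x _; exists 0%N.
- by move=> A oA; apply/eqP; rewrite eq_le (le_open mu nu)// (le_open nu mu).
- by move=> _; rewrite [X in (X < _)%E](@probability_setT _ _ _ P) ltry.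
Qed.

End weak_convergence.

(** * Exhaustion of open sets by closed sets, and limits of measurable maps *)

Section open_exhaustion.
Context {R : realType} {X : completeMetricType R}.

(** [C n] consists of the points at distance at least [1 / (n + 1)] from the complement of [U]. The
    last clause puts a sequence converging into [U] eventually inside a single [C n]. *)
Lemma open_bigcup_closed (U : set X) : open U -> exists C : nat -> set X,
  [/\ forall n, closed (C n), U = \bigcup_n C n &
      forall x, U x -> exists n, nbhs x (C n)].
Proof.
move=> oU; pose C n := [set x : X | forall y, ~ U y -> n.+1%:R^-1 <= mdist x y].
have CU n : C n `<=` U.
  move=> x Cnx; apply: contrapT => /Cnx.
  by rewrite mdistxx leNgt invr_gt0 ltr0Sn.
have UC x : U x -> exists n, nbhs x (C n).
  move=> Ux; have /nbhs_ballP[d /= d0 dU] : nbhs x U by exact: open_nbhs_nbhs.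
  have d2 : 0 < d / 2 by rewrite divr_gt0.
  have [n _ /(_ n (leqnn n))/= nd] := near_infty_natSinv_lt (PosNum d2).
  exists n; apply/nbhs_ballP; exists (d / 2) => // z; rewrite ballEmdist /= => xz y nUy.
  rewrite leNgt; apply/negP => zy; apply/nUy/dU; rewrite ballEmdist /=.
  rewrite (splitr d); apply: le_lt_trans (metric_triangle x z y) _.
  by apply: ltrD => //; exact: lt_trans zy nd.
exists C; split=> //.
- move=> n x cx y nUy; apply/ler_addgt0Pl => e e0.
  have [z [Cz]] := cx _ (nbhsx_ballx x e e0).
  rewrite ballEmdist /= => xz; have := Cz y nUy.
  move=> /le_trans; apply; apply: (le_trans (metric_triangle z x y)).
  by rewrite (metric_sym z x) lerD2r ltW.
- apply/seteqP; split => [x /UC[n /nbhs_singleton Cnx]|x [n _]]; last exact: CU.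
  by exists n.
Qed.

(** The limit is in [U] iff the sequence eventually stays in some [C k]: the neighbourhood clause
    gives one direction, closedness of [C k] the other. *)
Lemma measurable_fun_cvg_borel d (T : measurableType d) (f_ : nat -> T -> X)
    (f : T -> X) :
  (forall n, measurable_fun [set: T] (f_ n : T -> borelType X)) ->
  (forall t, f_ ^~ t @ \oo --> f t) ->
  measurable_fun [set: T] (f : T -> borelType X).
Proof.
move=> mf_ f_f; apply: (@measurability _ _ T (borelType X) _ _ (@open X)) => //.
move=> _ [U oU <-]; rewrite setTI; have [C [cC UC nC]] := open_bigcup_closed oU.
rewrite (_ : _ @^-1` _ = \bigcup_k \bigcup_m \bigcap_(n >= m) (f_ n @^-1` C k)).
  apply: bigcup_measurable => k _; apply: bigcup_measurable => m _.
  apply: bigcap_measurable => [|n _]; first by exists m => /=.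
  rewrite -[X in measurable X]setTI; apply: mf_ => //; exact: closed_borel.
apply/seteqP; split => [t /nC[k]|t [k _ [m _ Ct]]] /=.
  by move=> /f_f[m _ mk]; exists k => //; exists m.
rewrite UC; exists k => //; apply: (closed_cvg (C k) (cC k) _ (f t) (f_f t)).
by exists m.
Qed.

End open_exhaustion.

(** * Compactness from total boundedness *)

Section totally_bounded.
Context {R : realType} {X : completeMetricType R}.

Lemma totally_bounded_compact (A : set X) : closed A ->
  (forall e, 0 < e -> exists s : seq X, A `<=` [set x | exists2 y, y \in s & mdist y x < e]) ->
  compact A.
Proof.
move=> cA tb; rewrite compact_ultra => F FU FA.
have FP : ProperFilter F := ultra_proper.
(* Induction on the centres: an ultrafilter contains each ball or its complement, and a discarded
   ball shortens the list. Small balls in [F] make it Cauchy. *)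
have Fs e (s : seq X) : F [set x | exists2 y, y \in s & mdist y x < e] ->
    exists y, F (ball y e).
  elim: s => [F0|y s IH FS]; first by have [x [y]] := filter_ex F0.
  have [Fy|FNy] := in_ultra_setVsetC (ball y e) FU; first by exists y.
  apply: IH; apply: filterS (filterI FS FNy) => x [[z]].
  rewrite in_cons => /predU1P[->|zs] zx; last by exists z.
  by rewrite ballEmdist.
have Fc : cauchy_ex F.
  by move=> e e0; have [s As] := tb e e0; apply: (Fs e s); exact: filterS FA.
have /cvg_ex[p Fp] : cvg F by apply: cauchy_cvg; exact/cauchy_exP.
exists p; split => //; rewrite ((closure_id A).1 cA) => B /Fp FB.
exact: filter_ex (filterI FA FB).
Qed.

End totally_bounded.

(** * Inner regularity of finite Borel measures by closed sets *)

Section closed_regularity.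
Context {R : realType} {X : completeMetricType R}.
Local Notation Y := (borelType X).
Variable m : {finite_measure set Y -> \bar R}.
Local Open Scope ereal_scope.

Definition closed_inner (A : set X) := forall e : R, (0 < e)%R ->
  exists C : set X, [/\ closed C, C `<=` A & m (A `\` C) <= e%:E].

Lemma closed_closed_inner (A : set X) : closed A -> closed_inner A.
Proof.
move=> cA e e0; exists A; split => //.
by rewrite setDv (_ : m set0 = 0) ?measure0// lee_fin ltW.
Qed.

(** Finite unions are closed, and the mass they miss tends to 0 by continuity from above. *)
Lemma bigcup_closed_inner (C : nat -> set X) : (forall n, closed (C n)) ->
  closed_inner (\bigcup_n C n).
Proof.
move=> cC e e0; pose D n := \big[setU/set0]_(i < n) C i.
have cD n : closed (D n) by apply: closed_bigsetU => i _; exact: cC.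
have mC n : measurable (C n : set Y) by exact: closed_borel.
pose F n : set Y := \bigcup_n C n `\` D n.
have mF n : measurable (F n).
  by apply: measurableD; [exact: bigcup_measurable|exact: closed_borel].
have F0 : \bigcap_n F n = set0.
  apply/seteqP; split => // x Fx; have [[n _ Cnx] _] := Fx 0%N I.
  (* [D n] stops before index [n], so [C n] is first covered by [D n.+1]. *)
  by have [_] := Fx n.+1 I; apply; rewrite /D -bigcup_mkord; exists n => //=.
have : m \o F @ \oo --> 0.
  rewrite -(measure0 m) -F0; apply: nonincreasing_cvg_mu => //.
  - by rewrite ltey_eq fin_num_measure.
  - by rewrite F0.
  move=> i j ij; apply/subsetPset => x [Cx Dx]; split => // Dix; apply: Dx.
  move: Dix; rewrite /D -!bigcup_mkord => -[k /= ki Ckx]; exists k => //=.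
  exact: leq_trans ki ij.
move=> /fine_cvgP[_] /cvgrPdist_le/(_ _ e0)[n _ /(_ n (leqnn n))/=].
rewrite sub0r normrN => h; exists (D n); split => //.
  by move=> x; rewrite /D -bigcup_mkord => -[k _ Ckx]; exists k.
rewrite -[leLHS](fineK (fin_num_measure m _ (mF n))) lee_fin.
exact: le_trans (ler_norm _) h.
Qed.

Lemma open_closed_inner (U : set X) : open U -> closed_inner U.
Proof.
move=> /open_bigcup_closed[C [cC -> _]]; exact: bigcup_closed_inner.
Qed.

(** Countable subadditivity: the errors [e / 2 ^ n.+1] sum to [e]. *)
Let inner_bigcup_ub (B : nat -> set X) (C : nat -> set X) (e : R) : (0 < e)%R ->
  (forall n, measurable (B n : set Y)) -> (forall n, closed (C n)) ->
  (forall n, m (B n `\` C n) <= (e / (2 ^ n.+1)%:R)%:E) ->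
  forall A : set Y, measurable A -> A `<=` \bigcup_n (B n `\` C n) -> m A <= e%:E.
Proof.
move=> e0 mB cC BC A mA AB.
have mBC n : measurable (B n `\` C n : set Y).
  by apply: measurableD => //; exact: closed_borel.
apply: le_trans (measure_sigma_subadditive m mBC mA AB) _.
have := @epsilon_trick R (fun=> 0) e xpredT (fun=> lexx _) (ltW e0).
rewrite [X in _ <= X + _]eseries0// add0e; apply: le_trans.
apply: lee_nneseries => [n _ _|n _]; first exact: measure_ge0.
by rewrite add0e; exact: BC.
Qed.

(** Requiring the property of a set and of its complement yields a sigma-algebra, which contains the
    open sets. *)
Lemma borel_closed_inner (B : set Y) : measurable B -> closed_inner B.
Proof.
move=> mB; pose G := [set A : set Y |
  [/\ measurable A, closed_inner A & closed_inner (~` A)]].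
suff : G B by case.
have SG : sigma_algebra setT G.
  split.
  - split => //; first exact/closed_closed_inner/closed0.
    by rewrite setC0; exact/closed_closed_inner/closedT.
  - by move=> A [mA iA iA']; rewrite setTD; split; [exact: measurableC| |rewrite setCK].
  - move=> A GA; have mA n : measurable (A n) by have [] := GA n.
    have pos e n : (0 < e :> R)%R -> (0 < e / (2 ^ n.+1)%:R)%R.
      by move=> e0; rewrite divr_gt0// ltr0n expn_gt0.
    split; first exact: bigcup_measurable.
    (* The union of the [C n] need not be closed: half of [e] pays for the approximations [C n],
       half for replacing their union by a closed [D]. *)
    + move=> e e0; have e2 : (0 < e / 2)%R by rewrite divr_gt0.
      have /choice[C CP] n : exists C : set X, [/\ closed C, C `<=` A n &
          m (A n `\` C) <= (e / 2 / (2 ^ n.+1)%:R)%:E].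
        by have [_ + _] := GA n; apply; exact: pos.
      have cC n : closed (C n) by have [] := CP n.
      have [D [cD DC DCe]] := bigcup_closed_inner cC e2.
      have mC : measurable (\bigcup_n C n : set Y).
        by apply: bigcup_measurable => n _; exact: closed_borel.
      have mD := closed_borel cD.
      have CA : \bigcup_n C n `<=` \bigcup_n A n.
        by apply: subset_bigcup => n _; have [] := CP n.
      exists D; split => //; first exact: subset_trans CA.
      have m1 : measurable (\bigcup_n A n `\` \bigcup_n C n).
        by apply: measurableD => //; exact: bigcup_measurable.
      have m2 : measurable (\bigcup_n C n `\` D : set Y) by exact: measurableD.
      apply: (@le_trans _ _ (m ((\bigcup_n A n `\` \bigcup_n C n) `|`
                               (\bigcup_n C n `\` D)))).
        apply: le_measure; rewrite ?inE.
        * by apply: measurableD => //; exact: bigcup_measurable.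
        * exact: measurableU.
        * move=> x [Ax Dx]; have [Cx|Cx] := pselect ((\bigcup_n C n) x); [right|left];
          by split.
      apply: le_trans (measureU2 _ m1 m2) _; rewrite (splitr e) EFinD leeD//.
      apply: (inner_bigcup_ub e2 mA cC) => // [n|x [[n _ Anx] Cx]].
        by have [] := CP n.
      by exists n => //; split => // Cnx; apply: Cx; exists n.
    (* For the complement, the intersection of the approximants is already closed. *)
    + move=> e e0.
      have /choice[C CP] n : exists C : set X, [/\ closed C, C `<=` ~` A n &
          m (~` A n `\` C) <= (e / (2 ^ n.+1)%:R)%:E].
        by have [_ _] := GA n; apply; exact: pos.
      have cC n : closed (C n) by have [] := CP n.
      exists (\bigcap_n C n); split.
      * exact: closed_bigI.
      * by rewrite setC_bigcup; apply: subset_bigcap => n _; have [] := CP n.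
      * apply: (@inner_bigcup_ub (fun n => ~` A n) C) => //.
        - by move=> n; exact: measurableC.
        - by move=> n; have [] := CP n.
        - apply: measurableD; first by apply: measurableC; exact: bigcup_measurable.
          by apply: closed_borel; exact: closed_bigI.
        - rewrite setC_bigcup => x [Ax] /existsNP[n /not_implyP[_ Cx]].
          by exists n => //; split => //; exact: Ax.
apply: (smallest_sub SG _ mB) => U oU; split; first exact: open_borel.
  exact: open_closed_inner.
exact/closed_closed_inner/open_closedC.
Qed.

(** Intersecting a closed approximant with [K] makes it compact and loses no mass. *)
Lemma compact_support_radon (K : set X) : compact K -> m (~` K) = 0 -> radon m.
Proof.
move=> cK K0 B mB; apply/eqP; rewrite eq_le; apply/andP; split; last first.
  apply: ge_ereal_sup => _ [C [cC CB] <-].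
  by apply: le_measure; rewrite ?inE//; exact: compact_borel.
apply/lee_addgt0Pr => e e0; have [C [cC CB Ce]] := borel_closed_inner mB e0.
have mK : measurable (K : set Y) by exact: compact_borel.
have mC := closed_borel cC.
have mKC : measurable (K `&` C : set Y) by exact: measurableI.
have mBC : measurable (B `\` C) by exact: measurableD.
have mNK : measurable (~` K : set Y) by exact: measurableC.
apply: (@le_trans _ _ (m (K `&` C) + e%:E)); last first.
  rewrite leeD2r//; apply: ereal_sup_ubound; exists (K `&` C) => //.
  by split; [exact: compact_closedI|move=> x [_ /CB]].
apply: (@le_trans _ _ (m ((K `&` C) `|` ((B `\` C) `|` ~` K)))).
  apply: le_measure; rewrite ?inE//; first by apply: measurableU => //; exact: measurableU.
  move=> x Bx; have [Kx|Kx] := pselect (K x); last by right; right.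
  by have [Cx|Cx] := pselect (C x); [left|right; left].
apply: le_trans (measureU2 _ mKC _) _; first exact: measurableU.
rewrite leeD2l//; apply: le_trans (measureU2 _ mBC mNK) _.
by move: K0 => /= ->; rewrite adde0.
Qed.

End closed_regularity.

(** * The coding map of the iterated function system *)

Section coding_map.
Context {R : realType} {X : completeMetricType R} {N : nat}.
Variables (w : 'I_N -> X -> X) (p : 'I_N -> R) (lambda : R -> R).
Hypotheses (rate : common_rate w lambda) (p_gt0 : forall i, 0 < p i).
Hypothesis p_sum1 : \sum_(i < N) p i = 1.
Variable x0 : X.

(** Farther than 1 from [x0] the rate is at most [lambda 1 < 1], as for a Banach contraction;
    nearer, nonexpansiveness suffices. *)
Lemma invariant_ball : exists2 r, 0 < r & forall i x,
  mdist x x0 <= r -> mdist (w i x) x0 <= r.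
Proof.
have [l01 ldec l1 lw] := rate.
pose c := \big[Num.max/0]_(i < N) mdist (w i x0) x0.
have c0 : 0 <= c by exact: bigmax_ge_id.
have a0 : 0 < 1 - lambda 1 by rewrite subr_gt0 l1.
pose q := c / (1 - lambda 1); have q0 : 0 <= q by rewrite divr_ge0// ltW.
have qc : (1 - lambda 1) * q = c by rewrite /q mulrC divfK// gt_eqF.
have /andP[k0 k1] := l01 1 ler01.
(* The radius exceeds [c + 1], for points within 1 of [x0], and [q] secures
   [c <= (1 - lambda 1) * r], for the others. *)
exists (2 + 2 * c + q) => [|i x xr]; first lra.
apply: le_trans (metric_triangle _ (w i x0) _) _.
have ic : mdist (w i x0) x0 <= c by exact: le_bigmax.
have [x1|x1] := leP (mdist x x0) 1.
  by have := common_rate_lip rate i x x0; lra.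
have h1 : lambda (mdist x x0) * mdist x x0 <= lambda 1 * (2 + 2 * c + q).
  apply: ler_pM => //; rewrite ?mdist_ge0 ?ldec// ?ltW//.
  by case/andP: (l01 _ (mdist_ge0 x x0)).
have h2 := lw i x x0.
have : 0 <= (1 - lambda 1) * (2 + 2 * c) by rewrite mulr_ge0//; lra.
lra.
Qed.

Definition cum n := \sum_(i < N | (i < n)%N) p i.

(** The cells tile [[0, 1[]; outside it the value is [None], and [code_step] then returns [x0]. *)
Definition digit t := [pick j : 'I_N | cum j <= t < cum j.+1].

(* On the cell of digit [j], [t |-> (t - cum j) / p j] expands that cell onto
   [0, 1[, so iterating [code_step] from a constant reads off the digits of [t]. *)
Definition code_step (g : R -> X) t :=
  if digit t is Some j then w j (g ((t - cum j) / p j)) else x0.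

Definition ifs_code n := iter n code_step (fun=> x0).

Lemma cum0 : cum 0 = 0.
Proof. by rewrite /cum big_pred0. Qed.

Lemma cumN : cum N = 1.
Proof. by rewrite /cum -p_sum1; apply: eq_bigl => i; rewrite ltn_ord. Qed.

Lemma cumS (j : 'I_N) : cum j.+1 = cum j + p j.
Proof.
rewrite /cum (bigD1 j)//= addrC; congr (_ + _); apply: eq_bigl => i.
by rewrite ltnS ltn_neqAle andbC.
Qed.

Lemma le_cum m n : (m <= n)%N -> cum m <= cum n.
Proof.
move=> mn; rewrite /cum [leRHS](bigID (fun i : 'I_N => (i < m)%N))/=.
rewrite [X in _ <= X + _](eq_bigl (fun i : 'I_N => (i < m)%N)).
  by rewrite lerDl sumr_ge0// => i _; exact: ltW.
by move=> i /=; case: (ltnP i m) => im; rewrite ?andbF// (leq_trans im mn).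
Qed.

Lemma digitP (t : R) (j : 'I_N) : cum j <= t < cum j.+1 -> digit t = Some j.
Proof.
move=> tj; rewrite /digit; case: pickP => [k tk|/(_ j)]; last by rewrite tj.
congr Some; apply/val_inj/eqP; rewrite /= eqn_leq; apply/andP; split;
  rewrite leqNgt; apply/negP => /le_cum; move: tj tk => /andP[? ?] /andP[? ?]; lra.
Qed.

Lemma digit_some t : 0 <= t < 1 -> exists j, digit t = Some j.
Proof.
move=> /andP[t0 t1]; have ex : exists n, t < cum n by exists N; rewrite cumN.
(* The digit is the predecessor of the least [n] with [t < cum n]. *)
case: (ex_minnP ex) => -[|n]; first by rewrite cum0 ltNge t0.
move=> tn nmin; have nN : (n < N)%N by apply: nmin; rewrite cumN.
exists (Ordinal nN); apply: digitP; rewrite tn andbT leNgt /=; apply/negP.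
by move=> /nmin; rewrite ltnn.
Qed.

Lemma code_step_some (g : R -> X) t j : digit t = Some j ->
  code_step g t = w j (g ((t - cum j) / p j)).
Proof. by rewrite /code_step => ->. Qed.

Section close.
Variable r : R.
Hypotheses (r0 : 0 < r)
  (w_ball : forall i x, mdist x x0 <= r -> mdist (w i x) x0 <= r).

Lemma code_ball n t : mdist (ifs_code n t) x0 <= r.
Proof.
elim: n t => [|n IH] t /=; first by rewrite mdistxx ltW.
by rewrite /code_step; case: (digit t) => [j|]; [exact: w_ball|rewrite mdistxx ltW].
Qed.

(** Once two values are within [e] they remain so, the maps being nonexpansive; while they are
    farther apart, each step contracts by at least the factor [lambda e]. *)
Lemma iter_code_step_close e (g h : R -> X) : 0 < e ->
  (forall t, mdist (g t) x0 <= r) -> (forall t, mdist (h t) x0 <= r) ->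
  forall n t, mdist (iter n code_step g t) (iter n code_step h t) <=
    Num.max e (lambda e ^+ n * (2 * r)).
Proof.
move=> e0 gr hr; have [l01 ldec l1 lw] := rate.
have /andP[le0 _] := l01 _ (ltW e0).
elim=> [|n IH] t.
  rewrite expr0 mul1r le_max /=; apply/orP; right.
  apply: le_trans (metric_triangle _ x0 _) _; rewrite (metric_sym x0).
  by have := gr t; have := hr t; lra.
rewrite !iterS /code_step; case: (digit t) => [j|]; last first.
  by rewrite mdistxx le_max ltW.
set s := _ / _; have := IH s; set a := iter _ _ _ _; set b := iter _ _ _ _ => ab.
rewrite le_max; have [abe|abe] := leP (mdist a b) e.
  by rewrite (le_trans (common_rate_lip rate j a b)).
apply/orP; right; apply: le_trans (lw j a b) _; rewrite exprS -mulrA.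
move: ab; rewrite le_max leNgt abe/= => ab.
apply: ler_pM => //; rewrite ?mdist_ge0 ?ldec ?ltW//.
by case/andP: (l01 _ (mdist_ge0 a b)).
Qed.

Lemma code_close e : 0 < e -> exists n, forall m t, (n <= m)%N ->
  mdist (ifs_code n t) (ifs_code m t) <= e.
Proof.
move=> e0; have [l01 _ l1 _] := rate.
have /andP[le0 _] := l01 _ (ltW e0).
have le1 : `|lambda e| < 1 by rewrite gtr0_norm// l1.
have /cvgrPdist_le/(_ (e / (2 * r)))[|n _ /(_ n (leqnn n))/=] := cvg_expr le1.
  by rewrite divr_gt0// mulr_gt0.
rewrite sub0r normrN (ger0_norm (exprn_ge0 _ (ltW le0))) => ln.
(* [ifs_code m] is [n] steps applied to [ifs_code (m - n)], whose values stay in the ball, so the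
   bound is uniform in [t] and [m]. *)
exists n => m t nm; rewrite -(subnKC nm) /ifs_code iterD.
apply: le_trans (iter_code_step_close e0 _ _ n t) _.
- by move=> u; rewrite mdistxx ltW.
- by move=> u; exact: code_ball.
- by rewrite ge_max lexx/= -ler_pdivlMr// mulr_gt0.
Qed.

Definition coding t := lim (ifs_code ^~ t @ \oo).

Lemma cvg_coding t : ifs_code ^~ t @ \oo --> coding t.
Proof.
apply: cauchy_cvg; apply: cauchy_exP => e e0.
have e2 : 0 < e / 2 by rewrite divr_gt0.
have [n nP] := code_close e2; exists (ifs_code n t), n => // m /= nm.
by rewrite ballEmdist /=; apply: le_lt_trans (nP _ _ nm) _; lra.
Qed.

Lemma coding_close e : 0 < e ->
  exists n, forall t, mdist (ifs_code n t) (coding t) <= e.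
Proof.
move=> e0; have [n nP] := code_close e0; exists n => t.
apply/ler_addgt0Pr => d d0.
have /metricType_numDomainType.cvgrPdist_lt/(_ _ d0)[m _ mP] := @cvg_coding t.
have /= := mP (maxn n m) (leq_maxr n m); rewrite metric_sym => h.
apply: le_trans (metric_triangle _ (ifs_code (maxn n m) t) _) _.
by apply: lerD (ltW h); apply: nP; exact: leq_maxl.
Qed.

(** The limit of the recursion for [ifs_code], with one step more on the left than on the right;
    [w j] is nonexpansive. *)
Lemma coding_fix t j : digit t = Some j ->
  coding t = w j (coding ((t - cum j) / p j)).
Proof.
move=> tj; apply: mdist_positivity; apply/eqP; rewrite eq_le mdist_ge0 andbT.
set s := _ / _; suff H (e : R) : 0 < e -> mdist (coding t) (w j (coding s)) <= e + e.
  apply/ler_addgt0Pr => e e0; rewrite add0r (splitr e).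
  by apply: H; rewrite divr_gt0.
move=> e0; have /metricType_numDomainType.cvgrPdist_lt/(_ _ e0)[k _ kP] := @cvg_coding t.
have /metricType_numDomainType.cvgrPdist_lt/(_ _ e0)[l _ lP] := @cvg_coding s.
have /= h1 := kP (maxn k l).+1 (leqW (leq_maxl k l)).
have /= h2 := lP (maxn k l) (leq_maxr k l).
apply: le_trans (metric_triangle _ (ifs_code (maxn k l).+1 t) _) _.
apply: lerD; first exact: ltW.
rewrite /ifs_code iterS (code_step_some _ tj).
apply: le_trans (common_rate_lip rate _ _ _) _.
by rewrite metric_sym ltW.
Qed.

Lemma coding_ball t : mdist (coding t) x0 <= r.
Proof.
apply/ler_addgt0Pl => e e0; have [n nP] := coding_close e0.
apply: le_trans (metric_triangle _ (ifs_code n t) _) _.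
by rewrite metric_sym lerD// code_ball.
Qed.

(** A finite list exhausting the values of [ifs_code n]; the entry [x0] serves the [t] without a
    digit. *)
Fixpoint code_values n : seq X :=
  if n is n'.+1 then x0 :: [seq w j x | j <- enum 'I_N, x <- code_values n']
  else [:: x0].

Lemma code_valuesP n t : ifs_code n t \in code_values n.
Proof.
elim: n t => [|n IH] t; first by rewrite /= mem_seq1.
rewrite /ifs_code iterS /= in_cons /code_step; case: (digit t) => [j|]; last by rewrite eqxx.
apply/orP; right; apply/allpairsP; exists (j, ifs_code n ((t - cum j) / p j)).
by split; rewrite ?mem_enum//; exact: IH.
Qed.

(** The finitely many values of [ifs_code n], uniformly close to [coding], form a finite net. *)
Lemma compact_coding : compact (closure (range coding)).
Proof.
apply: totally_bounded_compact; first exact: closed_closure.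
move=> e e0; have e2 : 0 < e / 2 by rewrite divr_gt0.
have [n nP] := coding_close e2; exists (code_values n) => x cx.
have [y [[t _ <-]]] := cx _ (nbhsx_ballx x _ e2).
rewrite ballEmdist/= => xt; exists (ifs_code n t); first exact: code_valuesP.
apply: le_lt_trans (metric_triangle _ (coding t) _) _.
by rewrite (metric_sym (coding t)); have := nP t; lra.
Qed.

End close.
End coding_map.

(** * Lebesgue measure under affine maps *)

Section lebesgue_affine.
Context {R : realType}.
Local Notation leb := (@lebesgue_measure R).

Lemma measurable_affine (a c : R) :
  measurable_fun [set: measurableTypeR R]
    ((fun t => (t - c) / a) : measurableTypeR R -> measurableTypeR R).
Proof.
apply: measurable_funM => //; apply: measurable_funB => //; exact: measurable_id.
Qed.

(** The push-forward, rescaled by [a^-1], agrees with Lebesgue measure on half-open intervals, which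
    characterise it. *)
Lemma lebesgue_measure_affine (a c : R) (S : set (measurableTypeR R)) :
  0 < a -> measurable S ->
  leb ((fun t => (t - c) / a) @^-1` S) = (a%:E * leb S)%E.
Proof.
move=> a0 mS; have ai0 : 0 <= a^-1 by rewrite invr_ge0 ltW.
pose nu : {measure set (measurableTypeR R) -> \bar R} := mscale (NngNum ai0)
  (measure_function_pushforward__canonical__measure_function_Measure leb
    (measurable_affine a c)).
have -> : leb S = nu S.
  apply: lebesgue_measure_unique => // _ [[u v] _ <-] /=.
  rewrite /nu /mscale /= /pushforward.
  rewrite (_ : _ @^-1` _ = `](u * a + c), (v * a + c)]%classic); last first.
    apply/seteqP; split => t /=; rewrite !in_itv/= ltr_pdivlMr// ler_pdivrMr//;
    by rewrite ltrBrDr lerBlDr.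
  rewrite !lebesgue_measure_itv/= !lte_fin ltrD2r ltr_pM2r//.
  case: ifPn => _; last by rewrite mule0.
  by rewrite -!EFinB -EFinM; congr EFin; field; rewrite gt_eqF.
by rewrite /nu /mscale /= muleA -EFinM divff ?gt_eqF// mul1e.
Qed.

End lebesgue_affine.

(** * The law of the coding map, an invariant Radon probability *)

Section coding_law.
Context {R : realType} {X : completeMetricType R} {N : nat}.
Variables (w : 'I_N -> X -> X) (p : 'I_N -> R) (lambda : R -> R).
Hypotheses (rate : common_rate w lambda) (p_gt0 : forall i, 0 < p i).
Hypothesis p_sum1 : \sum_(i < N) p i = 1.
Hypothesis w_cont : forall i, continuous (w i).
Variables (x0 : X) (r : R).
Hypotheses (r0 : 0 < r)
  (w_ball : forall i x, mdist x x0 <= r -> mdist (w i x) x0 <= r).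
Local Notation Y := (borelType X).
Local Notation leb := (@lebesgue_measure R).
Local Notation ifs_code := (ifs_code w p x0).
Local Notation coding := (coding w p x0).
Local Notation cum := (cum p).

Definition cell (j : 'I_N) : set (measurableTypeR R) := `[cum j, cum j.+1[%classic.

Lemma cellP t j : cell j t <-> digit p t = Some j.
Proof.
split; first by rewrite /cell /= in_itv/=; exact: digitP.
by rewrite /digit /cell /= in_itv/=; case: pickP => // k tk [<-].
Qed.

Let affine (j : 'I_N) (t : R) := (t - cum j) / p j.

Lemma measurable_code_step (g : R -> X) :
  measurable_fun [set: measurableTypeR R] (g : measurableTypeR R -> Y) ->
  measurable_fun [set: measurableTypeR R] (code_step w p x0 g : measurableTypeR R -> Y).
Proof.
move=> mg _ B mB; rewrite setTI.
have mcell j : measurable (cell j) by exact: measurable_itv.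
(* The preimage is split by digit; the last piece holds the points without one. *)
rewrite (_ : _ @^-1` _ = \big[setU/set0]_(j < N)
    (cell j `&` affine j @^-1` (g @^-1` (w j @^-1` B))) `|`
  (~` (\big[setU/set0]_(j < N) cell j) `&` [set _ | B x0])).
  apply: measurableU.
    apply: bigsetU_measurable => j _; apply: measurableI => //.
    rewrite -[X in measurable X]setTI; apply: measurable_affine => //.
    rewrite -[X in measurable X]setTI; apply: mg => //.
    by rewrite -[X in measurable X]setTI; apply: continuous_borel_fun.
  apply: measurableI; first by apply: measurableC; exact: bigsetU_measurable.
  have [Bx|Bx] := pselect (B x0).
    by rewrite (_ : mkset _ = setT)//; apply/seteqP; split.
  by rewrite (_ : mkset _ = set0)//; apply/seteqP; split.
rewrite -!bigcup_seq; apply/seteqP; split => t /=.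
  rewrite /code_step; case tj : (digit p t) => [j|] Bt; [left|right].
    by exists j; [rewrite /= mem_index_enum|split => //; exact/cellP].
  by split => // -[j _ /cellP]; rewrite tj.
case=> [[j _ [/cellP tj Bt]]|[nt Bx]]; first by rewrite (code_step_some _ _ _ tj).
rewrite /code_step; case tj : (digit p t) => [j|//]; case: nt; exists j; last exact/cellP.
by rewrite /= mem_index_enum.
Qed.

Lemma measurable_code n : measurable_fun [set: measurableTypeR R] (ifs_code n : measurableTypeR R -> Y).
Proof. by elim: n => [|n IH] //=; exact: measurable_code_step. Qed.

Lemma measurable_coding : measurable_fun [set: measurableTypeR R] (coding : measurableTypeR R -> Y).
Proof.
apply: (measurable_fun_cvg_borel measurable_code).
exact: (cvg_coding rate r0 w_ball).
Qed.

Let I01 : set (measurableTypeR R) := `[0, 1[%classic.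

Let mI01 : measurable I01.
Proof. exact: measurable_itv. Qed.

Let leb01 : {measure set (measurableTypeR R) -> \bar R} := mrestr leb mI01.

Let coding_image : {measure set Y -> \bar R} :=
  measure_function_pushforward__canonical__measure_function_Measure leb01
    measurable_coding.

Let coding_image1 : coding_image [set: Y] = 1%E.
Proof.
rewrite /coding_image /= /pushforward /leb01 /= /mrestr preimage_setT setTI.
by rewrite lebesgue_measure_itv/= lte_fin ltr01 -EFinB subr0.
Qed.

Definition coding_law : probability Y R := pmeasurable coding_image1.

Lemma coding_lawE B : measurable B ->
  coding_law B = leb (coding @^-1` B `&` `[0, 1[%classic).
Proof. by move=> mB; rewrite /coding_law /= mmeasurableE. Qed.

(** On cell [j], [coding] is [w j] after [coding] after the affine expansion onto [[0, 1[], and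
    preimages under that expansion have their Lebesgue measure multiplied by [p j]. *)
Lemma coding_law_invariant (B : set Y) : measurable B ->
  coding_law B = (\sum_(j < N) (p j)%:E * coding_law (w j @^-1` B))%E.
Proof.
move=> mB; have mw j : measurable (w j @^-1` B : set Y).
  by rewrite -[X in measurable X]setTI; apply: continuous_borel_fun.
have mc A : measurable (A : set Y) -> measurable (coding @^-1` A : set (measurableTypeR R)).
  by move=> mA; rewrite -[X in measurable X]setTI; exact: measurable_coding.
have mcell j : measurable (cell j) by exact: measurable_itv.
rewrite coding_lawE// (_ : _ `&` _ =
    \big[setU/set0]_(j < N) (coding @^-1` B `&` cell j)); last first.
  rewrite -bigcup_seq; apply/seteqP; split => t /= [].
    move=> Bt t01; have /(digit_some p_gt0 p_sum1)[j tj] : 0 <= t < 1.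
      by move: t01; rewrite in_itv.
    by exists j; [rewrite /= mem_index_enum|split => //; exact/cellP].
  move=> j _ [Bt]; rewrite /cell /= !in_itv/= => /andP[tj tj1]; split => //.
  rewrite (le_trans _ tj) -?(cum0 p) ?le_cum//=.
  by rewrite (lt_le_trans tj1)// -(cumN p_sum1) le_cum.
rewrite measure_semi_additive_ord//.
- apply: eq_bigr => j _; rewrite coding_lawE// -(lebesgue_measure_affine (cum j)) //.
    congr (leb _); apply/seteqP; split => t /=.
      move=> [Bt /cellP tj]; split.
        by move: Bt; rewrite (coding_fix rate r0 w_ball tj).
      move/cellP : tj; rewrite /cell /= !in_itv/= cumS => /andP[h1 h2].
      by rewrite divr_ge0 ?subr_ge0 ?(ltW (p_gt0 j))//= ltr_pdivrMr// mul1r ltrBlDl.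
    rewrite in_itv/= ltr_pdivrMr// mul1r ltrBlDl -cumS => -[Bt /andP[h1 h2]].
    have tj : cell j t.
      rewrite /cell /= in_itv/= h2 andbT -subr_ge0.
      by move: h1; rewrite pmulr_lge0// invr_gt0.
    by split => //; move/cellP: tj => /(coding_fix rate r0 w_ball) ->.
  by apply: measurableI; [exact: mc|exact: measurable_itv].
- by move=> j; apply: measurableI => //; exact: mc.
- apply/trivIsetP => j k _ _ jk; apply/seteqP; split => // t [[_ /cellP tj] [_ /cellP]].
  by rewrite tj => -[jk']; rewrite jk' eqxx in jk.
- by apply: bigsetU_measurable => j _; apply: measurableI => //; exact: mc.
Qed.

Lemma coding_law_radon : radon coding_law.
Proof.
suff K0 : coding_law (~` closure (range coding)) = 0%E.
  exact: (compact_support_radon (compact_coding rate r0 w_ball) K0).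
rewrite coding_lawE; last first.
  by apply: measurableC; apply: closed_borel; exact: closed_closure.
rewrite (_ : _ `&` _ = set0) ?measure0//; apply/seteqP; split => // t [/= nt _].
by apply: nt; apply: subset_closure; exists t.
Qed.

Lemma coding_law_integrable1 : integrable1 coding_law.
Proof.
exists x0; rewrite (eq_measure_integral coding_image); last first.
  by move=> A mA _; rewrite /coding_law /= mmeasurableE.
have md : measurable_fun [set: Y] (fun x : Y => (mdist (x : X) x0)%:E).
  by apply/measurable_EFinP; exact: lip_borel (mdist_lip x0).
rewrite ge0_integral_pushforward//; first last.
- by move=> x _; rewrite lee_fin mdist_ge0.
- exact: measurable_coding.
apply: (@le_lt_trans _ _ (\int[leb01]_x (cst r%:E) x)%E).
  apply: ge0_le_integral => //.
  - by rewrite preimage_setT.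
  - by move=> x _; rewrite lee_fin mdist_ge0.
  - by rewrite preimage_setT; apply: measurableT_comp => //; exact: measurable_coding.
  - by move=> t _; rewrite lee_fin; exact: (coding_ball p rate r0 w_ball).
rewrite integral_cst// lte_mul_pinfty ?lee_fin ?ltW//.
by move: coding_image1; rewrite /coding_image /= /pushforward preimage_setT => ->; exact: ltry.
Qed.

End coding_law.

(** * Convergence of the iterates and the fixed point *)

Lemma rakotch_cvg0 (R : realType) (l : R -> R) (u : nat -> R) :
  (forall t, 0 <= t -> 0 <= l t <= 1) ->
  (forall s t, 0 <= s -> s <= t -> l t <= l s) ->
  (forall t, 0 < t -> l t < 1) ->
  (forall n, 0 <= u n) -> (forall n, u n.+1 <= l (u n) * u n) ->
  u @ \oo --> (0 : R).
Proof.
move=> l01 ldec l1 u0 ul.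
have udec : nonincreasing_seq u.
  apply/nonincreasing_seqP => n; apply: le_trans (ul n) _.
  by rewrite ler_piMl//; case/andP: (l01 _ (u0 n)).
apply/cvgrPdist_lt => e e0.
(* Were [u] to stay above [e], each step would contract by [l e < 1], and the geometric decay would
   bring it below [e]. *)
have [n un] : exists n, u n < e.
  apply: contrapT => /forallNP ne; have eu n : e <= u n by rewrite leNgt; exact/negP.
  have /andP[le0 _] := l01 _ (ltW e0).
  have ugeo n : u n <= l e ^+ n * u 0%N.
    elim: n => [|n IH]; first by rewrite expr0 mul1r.
    apply: le_trans (ul n) _; rewrite exprS -mulrA.
    by apply: ler_pM => //; [case/andP: (l01 _ (u0 n))|apply: ldec => //; exact: ltW].
  have le1 : `|l e| < 1 by rewrite ger0_norm// l1.
  have u00 : 0 < u 0%N by exact: lt_le_trans (eu 0%N).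
  have eu0 : 0 < e / u 0%N by rewrite divr_gt0.
  have /cvgrPdist_lt/(_ _ eu0)[n _ /(_ n (leqnn n))/=] := cvg_expr le1.
  rewrite sub0r normrN (ger0_norm (exprn_ge0 _ le0)) ltr_pdivlMr// => h.
  by have := lt_le_trans h (eu n); rewrite ltNge ugeo.
exists n => // m /= nm; rewrite sub0r normrN ger0_norm//.
exact: le_lt_trans (udec _ _ nm) un.
Qed.

Lemma markov_fixpoint_exists (R : realType) (X : completeMetricType R) (N : nat)
    (w : 'I_N -> X -> X) (p : 'I_N -> R) (w_cont : forall i, continuous (w i))
    (p_gt0 : forall i, 0 < p i) (p_sum1 : \sum_(i < N) p i = 1) lambda :
  common_rate w lambda ->
  exists2 mu : signed_radon R X, prob1 mu & markov_operator w_cont p_gt0 mu = mu.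
Proof.
move=> rate; have [r r0 w_ball] := invariant_ball rate point.
pose P := coding_law rate p_gt0 w_cont r0 w_ball.
have rP : radon P := coding_law_radon rate p_gt0 w_cont r0 w_ball.
have [mu muP] := signed_radon_exists rP.
exists mu.
  apply: (eq_prob1 muP) => //; first exact: probability_setT.
  exact: coding_law_integrable1.
apply: signed_radon_ext => B mB; rewrite (markov_operatorE _ _ muP)// muP//.
by rewrite [RHS](coding_law_invariant rate p_gt0 p_sum1).
Qed.

Theorem theorem2p21 (R : realType) (X : completeMetricType R) (N : nat)
    (w : 'I_N -> X -> X) (p : 'I_N -> R)
    (w_rakotch : forall i, rakotch_contraction (@mdist R X) [set: X] (w i))
    (p_gt0 : forall i, 0 < p i) (p_sum1 : \sum_(i < N) p i = 1) :
  let M : signed_radon R X -> signed_radon R X :=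
    markov_operator (fun i => rakotch_continuous (w_rakotch i)) p_gt0 in
  [/\ M @` prob1 `<=` prob1,
      rakotch_contraction dMK prob1 M &
      exists mu_star : signed_radon R X,
        [/\ prob1 mu_star, M mu_star = mu_star,
            forall mu, prob1 mu -> M mu = mu -> mu = mu_star &
            forall mu, prob1 mu -> weak_cvg (fun k => iter k M mu) mu_star]].
Proof.
move=> M; have [lambda rate] := rakotch_common_rate w_rakotch.
have MR : rakotch_contraction dMK prob1 M by exact: markov_rakotch.
have [MP [l [l01 ldec l1 lM]]] := MR.
split=> //; first by move=> _ [mu pmu <-]; exact: MP.
have [nu pnu Mnu] := markov_fixpoint_exists
  (fun i => rakotch_continuous (w_rakotch i)) p_gt0 p_sum1 rate.
exists nu; split => // [mu pmu Mmu|mu pmu].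
  (* Two fixed points at positive distance would be strictly closer to each other than they are. *)
  have fix0 (m1 m2 : signed_radon R X) : prob1 m1 -> prob1 m2 -> M m1 = m1 ->
      M m2 = m2 -> dMK m1 m2 = 0.
    move=> p1 p2 E1 E2; apply/eqP; rewrite eq_le dMK_ge0// andbT leNgt; apply/negP => d0.
    have := lM _ _ p1 p2; rewrite E1 E2 leNgt => /negP; apply.
    by rewrite gtr_pMl// l1.
  by apply: dMK_eq0 => //; exact: fix0.
have pk k : prob1 (iter k M mu) by elim: k => //= k IH; exact: MP.
apply: dMK_weak_cvg => //; apply: (rakotch_cvg0 l01 ldec l1) => k.
  exact: dMK_ge0.
(* Writing [nu] as [M nu] gives the distances to the iterates the recursion of [rakotch_cvg0]. *)
by rewrite /= -[in leLHS]Mnu; exact: lM.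
Qed.
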